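(* Let $P u=\partial_t u-a^{ij}(t,x)D_{ij}u$ on $\mathbb{R}^{d+1}$, where the coefficient matrix $\mathbf{A}=(a^{ij}(t,x))$ is symmetric and satisfies $\lambda|\xi|^2\le a^{ij}(t,x)\xi_i\xi_j\le\Lambda|\xi|^2$ for all $\xi\in\mathbb{R}^d$ and all $(t,x)\in\mathbb{R}^{d+1}$, with constants $0<\lambda\le\Lambda<\infty$. Suppose that the formal adjoint operator $P^*v=-\partial_t v-D_{ij}(a^{ij}(t,x)v)$ satisfies the weak Harnack inequality. Given $T>0$, let $N_0$ be the constant associated with $R_0=\sqrt{T}$ in the weak Harnack inequality. Then the fundamental solution $\Gamma(t,x,s,y)$ of $P$ satisfies the lower Gaussian bound: for any $x,y\in\mathbb{R}^d$ and $t,s\in\mathbb{R}$ such that $0<t-s<T$, $$\Gamma(t,x,s,y)\ge\frac{1}{N(t-s)^{d/2}}\exp\left\{-\frac{|x-y|^2}{\kappa(t-s)}\right\},$$ where $\kappa>0$ is a constant depending only on $d,\lambda,\Lambda$, and $N>0$ is a constant depending only on $d,\lambda,\Lambda,N_0$.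
   Context: Summation over repeated indices $i,j=1,\dots,d$ is understood. $B_\rho(x_0)$ is the open ball in $\mathbb{R}^d$ of radius $\rho$ centered at $x_0$, and for $X_0=(t_0,x_0)\in\mathbb{R}^{d+1}$ and $\rho>0$, $$C_\rho(X_0)=(t_0,t_0+\rho^2)\times B_\rho(x_0).$$ Weak Harnack inequality: $P^*$ satisfies the weak Harnack inequality for solutions if, for any nonnegative solution $u$ of $P^*u=0$ in $C_{2r}(X_0)$, where $X_0=(t_0,x_0)\in\mathbb{R}^{d+1}$ and $0<r<R_0$, the estimate $$N_0\inf_{C_r(X_0)}u\ge\frac{1}{r^2|B_r(x_0)|}\int_{t_0+2r^2}^{t_0+3r^2}\int_{B_r(x_0)}u(t,x)\,dx\,dt$$ holds. Here $N_0>0$ may depend on $R_0$, but it is uniform for all $r\in(0,R_0)$ and $X_0\in\mathbb{R}^{d+1}$, and is independent of $u$. Fundamental solution: a fundamental solution $\Gamma(t,x,s,y)$ for $P$ is a function satisfying $P\Gamma(\cdot,\cdot,s,y)=\delta_{s,y}$ in $\mathbb{R}^{d+1}$, or equivalently $P\Gamma(\cdot,\cdot,s,y)=0$ in $(s,\infty)\times\mathbb{R}^d$ and $\lim_{t\searrow s}\Gamma(t,\cdot,s,y)=\delta_y$ on $\mathbb{R}^d$. As usual, $\Gamma$ is the nonnegative fundamental solution with $\Gamma=0$ for $t<s$; for bounded initial data $f$ (such as indicator functions of balls), $u(t,x)=\int_{\mathbb{R}^d}\Gamma(t,x,\tau,z)f(z)\,dz$ is the bounded solution of $Pu=0$ in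 $(\tau,\infty)\times\mathbb{R}^d$ with $u(\tau,\cdot)=f$; and for fixed $(t,x)$ the function $(s,y)\mapsto\Gamma(t,x,s,y)$ solves $P^*\Gamma(t,x,\cdot,\cdot)=0$ in $(-\infty,t)\times\mathbb{R}^d$. Conventions: the equation $P^*u=0$ is understood in the sense of distributions (the $a^{ij}$ are not assumed differentiable). Since adjoint solutions are a priori defined up to null sets, suprema and infima of them are essential, and pointwise inequalities for $\Gamma$ are understood with the usual choice of representative of $\Gamma(t,x,\cdot,\cdot)$. *)

(* Defs.v *)
From HB Require Import structures.
From mathcomp Require Import all_boot all_order all_algebra.
From mathcomp Require Import all_classical all_reals all_analysis.

Set Implicit Arguments.
Unset Strict Implicit.
Unset Printing Implicit Defensive.

Import Order.TTheory GRing.Theory Num.Theory.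
Import numFieldTopology.Exports numFieldNormedType.Exports.

Local Open Scope classical_set_scope.
Local Open Scope ring_scope.

(* MathComp-Analysis has no Lebesgue measure on ['rV[R]_d].  Here the
   sigma-algebra is generated by the coordinates, as for [n.-tuple] in the
   library, so it is the Borel one, and the measure is the [d]-fold product of
   [lebesgue_measure]. *)

Definition rV_coord {R : realType} {d : nat} (i : 'I_d) (v : 'rV[R]_d) :
  measurableTypeR R := v ord0 i.

Definition rV_display : measure_display -> measure_display.
Proof. exact. Qed.

Section rV_measurable.
Context {R : realType} {d : nat}.

Let rV_set0 : g_sigma_preimage (@rV_coord R d) set0.
Proof. exact: sigma_algebra0. Qed.

Let rV_setC A : g_sigma_preimage (@rV_coord R d) A ->
  g_sigma_preimage (@rV_coord R d) (~` A).
Proof. exact: sigma_algebraC. Qed.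

Let rV_bigcup (F : (set 'rV[R]_d)^nat) :
  (forall i, g_sigma_preimage (@rV_coord R d) (F i)) ->
  g_sigma_preimage (@rV_coord R d) (\bigcup_i F i).
Proof. exact: sigma_algebra_bigcup. Qed.

HB.instance Definition _ := @isMeasurable.Build
  (rV_display default_measure_display) 'rV[R]_d
  (g_sigma_preimage (@rV_coord R d)) rV_set0 rV_setC rV_bigcup.

End rV_measurable.

Lemma measurable_rV_coord {R : realType} d (i : 'I_d) :
  measurable_fun [set: 'rV[R]_d] (rV_coord i).
Proof.
move=> _ Y mY; rewrite setTI; apply: sub_sigma_algebra => /=.
rewrite -bigcup_seq/=; exists i => /=; first by rewrite mem_index_enum.
by exists Y => //; rewrite setTI.
Qed.

Lemma measurable_fun_rVP {R : realType} d d1 (T : measurableType d1)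
    (f : T -> 'rV[R]_d) :
  measurable_fun [set: T] f <->
  forall i, measurable_fun [set: T] (rV_coord i \o f).
Proof.
split=> [mf i|mf]; first by apply: measurableT_comp => //; exact: measurable_rV_coord.
have sub : g_sigma_preimage (fun i => rV_coord i \o f) `<=` measurable.
  apply: smallest_sub; first exact: sigma_algebra_measurable.
  case: d => [|d] in f mf *; first by rewrite big_ord0.
  rewrite -bigcup_mkord_ord; apply: bigcup_sub => i Ii.
  by move=> A [B mB <-]; exact: mf.
move=> _ A mA; apply: sub; rewrite g_sigma_preimage_comp.
by exists A.
Qed.

Definition rV_cons {R : realType} {d : nat} (xv : measurableTypeR R * 'rV[R]_d) :
    'rV[R]_d.+1 :=
  \row_i (if unlift ord0 i is Some j then xv.2 ord0 j else xv.1).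

Definition rV_uncons {R : realType} {d : nat} (w : 'rV[R]_d.+1) :
    measurableTypeR R * 'rV[R]_d :=
  (w ord0 ord0, \row_j w ord0 (lift ord0 j)).

Lemma rV_consK {R : realType} d : cancel (@rV_cons R d) rV_uncons.
Proof.
move=> [x v]; rewrite /rV_uncons /rV_cons mxE unlift_none; congr pair.
by apply/rowP => j; rewrite !mxE liftK.
Qed.

Lemma measurable_rV_cons {R : realType} d :
  measurable_fun [set: measurableTypeR R * 'rV[R]_d] rV_cons.
Proof.
apply/measurable_fun_rVP => i; case: (unliftP ord0 i) => [j|] ->.
- rewrite (_ : _ \o _ = rV_coord j \o snd).
    by apply: measurableT_comp => //; exact: measurable_rV_coord.
  by apply/funext => z; rewrite /= /rV_coord mxE liftK.
- rewrite (_ : _ \o _ = fst) //.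
  by apply/funext => z; rewrite /= /rV_coord mxE unlift_none.
Qed.

Lemma measurable_rV_uncons {R : realType} d :
  measurable_fun [set: 'rV[R]_d.+1] rV_uncons.
Proof.
apply/measurable_fun_pairP; split; first exact: measurable_rV_coord.
apply/measurable_fun_rVP => i.
rewrite (_ : _ \o _ = rV_coord (lift ord0 i)); first exact: measurable_rV_coord.
by apply/funext => z; rewrite /= /rV_coord mxE.
Qed.

Section cons_measure.
Context {R : realType} {d : nat}.
Variable mu : {sigma_finite_measure set 'rV[R]_d -> \bar R}.

Let nu : set 'rV[R]_d.+1 -> \bar R :=
  pushforward (lebesgue_measure \x mu)%E rV_cons.

Let mcons (A : set 'rV[R]_d.+1) : measurable A ->
  measurable ((rV_cons : measurableTypeR R * 'rV[R]_d -> _) @^-1` A).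
Proof. by move=> mA; rewrite -[X in measurable X]setTI; exact: measurable_rV_cons. Qed.

Let nu0 : nu set0 = 0%E.
Proof. by rewrite /nu /pushforward preimage_set0 measure0. Qed.

Let nu_ge0 A : (0 <= nu A)%E.
Proof. by rewrite /nu /pushforward; exact: measure_ge0. Qed.

Let nu_sigma_additive : semi_sigma_additive nu.
Proof.
move=> F mF tF mUF; rewrite /nu /pushforward preimage_bigcup.
apply: measure_semi_sigma_additive.
- by move=> n; exact: mcons.
- apply/trivIsetP => /= i j _ _ ij; rewrite -preimage_setI.
  by move/trivIsetP : tF => /(_ _ _ _ _ ij) ->//; rewrite preimage_set0.
- by rewrite -preimage_bigcup; exact: mcons.
Qed.

HB.instance Definition _ := isMeasure.Build _ _ _ nu
  nu0 nu_ge0 nu_sigma_additive.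

Let nu_sigma_finite : sigma_finite setT nu.
Proof.
(* Given by name: the canonical instance on [\x] is shadowed in the library by
   the one for subprobabilities. *)
have [[F FT mF]] :=
  lebesgue_integral_fubini.measure_function_Measure_isSigmaFinite__to__measure_function_isSigmaFinite
    lebesgue_measure mu.
exists (fun n => rV_uncons @^-1` F n).
  by rewrite -preimage_bigcup -FT preimage_setT.
move=> n; have [mFn Fn] := mF n; split.
  by rewrite -[X in measurable X]setTI; exact: measurable_rV_uncons.
rewrite /nu /pushforward -comp_preimage (_ : _ \o _ = id) ?preimage_id//.
by apply/funext => z /=; rewrite rV_consK.
Qed.

HB.instance Definition _ := Measure_isSigmaFinite.Build _ _ _ nu
  nu_sigma_finite.

Definition cons_measure : {sigma_finite_measure set 'rV[R]_d.+1 -> \bar R} := nu.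

End cons_measure.

Fixpoint lebesgue_rV {R : realType} (d : nat) :
    {sigma_finite_measure set 'rV[R]_d -> \bar R} :=
  match d with
  | 0 => dirac (0 : 'rV[R]_0)
  | d'.+1 => cons_measure (@lebesgue_rV R d')
  end.
Arguments lebesgue_rV {R} d.

(* The canonical norm on ['rV[R]_d] is the sup norm, not the Euclidean one. *)

Definition enorm {R : realType} {d : nat} (x : 'rV[R]_d) : R :=
  Num.sqrt (\sum_i x ord0 i ^+ 2).

Definition eball {R : realType} {d : nat} (x : 'rV[R]_d) (r : R) : set 'rV[R]_d :=
  [set y | enorm (y - x) < r].

Definition cylinder {R : realType} {d : nat} (t : R) (x : 'rV[R]_d) (r : R) :
  set (R * 'rV[R]_d) := `]t, t + r ^+ 2[ `*` eball x r.

Definition lebesgue_tx {R : realType} (d : nat) :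
    {measure set (measurableTypeR R * 'rV[R]_d)%type -> \bar R} :=
  (lebesgue_measure \x lebesgue_rV d)%E.
Arguments lebesgue_tx {R} d.

Definition dir_t {R : realType} {d : nat} : R * 'rV[R]_d := (1, 0).
Definition dir_x {R : realType} {d : nat} (i : 'I_d) : R * 'rV[R]_d :=
  (0, delta_mx ord0 i).

(* [iter_derive [:: v1; v2] f] is [D_v1 (D_v2 f)]. *)
Definition iter_derive {R : realType} {V : normedModType R}
    (vs : seq V) (f : V -> R) : V -> R :=
  foldr (fun v g => 'D_v g) f vs.

(* In finite dimension this is C^infinity: all iterated directional derivatives
   exist and are continuous. *)
Definition smooth {R : realType} {V : normedModType R} (f : V -> R) : Prop :=
  forall vs : seq V, continuous (iter_derive vs f) /\
    forall x v, derivable (iter_derive vs f) x v.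

Definition test_function {R : realType} {V : normedModType R} (D : set V)
    (f : V -> R) : Prop :=
  smooth f /\
  exists K : set V, [/\ compact K, K `<=` D & forall x, ~ K x -> f x = 0].

Definition locally_integrable_tx {R : realType} {d : nat}
    (D : set (R * 'rV[R]_d)) (f : R * 'rV[R]_d -> R) : Prop :=
  measurable_fun (D : set (measurableTypeR R * 'rV[R]_d)) f /\
  forall K : set (R * 'rV[R]_d), compact K -> K `<=` D ->
    (lebesgue_tx d).-integrable K (EFin \o f).

Definition weak_derivative {R : realType} {d : nat} (D : set (R * 'rV[R]_d))
    (vs : seq (R * 'rV[R]_d)) (u g : R * 'rV[R]_d -> R) : Prop :=
  locally_integrable_tx D g /\
  forall phi, test_function D phi ->
    \int[lebesgue_tx d]_(z in D) (u z * iter_derive vs phi z) =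
    (-1) ^+ size vs * \int[lebesgue_tx d]_(z in D) (g z * phi z).

Definition elliptic {R : realType} {d : nat} (lambda Lambda : R)
    (a : R -> 'rV[R]_d -> 'M[R]_d) : Prop :=
  [/\ forall i j, measurable_fun [set: measurableTypeR R * 'rV[R]_d]
        (fun z => a z.1 z.2 i j : R),
      forall t x, (a t x)^T = a t x
    & forall t x (xi : 'rV[R]_d),
        lambda * enorm xi ^+ 2
          <= \sum_i \sum_j a t x i j * xi ord0 i * xi ord0 j
          <= Lambda * enorm xi ^+ 2].

(* Continuous strong solutions of [P u = 0] in the local Sobolev space
   [W^{1,2}_1].  These include the continuous strong solutions in [W^{1,2}_p]
   for all p >= 1, and the classical solutions. *)
Definition solution {R : realType} {d : nat} (a : R -> 'rV[R]_d -> 'M[R]_d)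
    (D : set (R * 'rV[R]_d)) (u : R * 'rV[R]_d -> R) : Prop :=
  (forall z, D z -> {for z, continuous u}) /\
  exists (ut : R * 'rV[R]_d -> R) (Du : 'I_d -> R * 'rV[R]_d -> R)
         (D2u : 'I_d -> 'I_d -> R * 'rV[R]_d -> R),
    [/\ weak_derivative D [:: dir_t] u ut,
        forall i, weak_derivative D [:: dir_x i] u (Du i),
        forall i j, weak_derivative D [:: dir_x i; dir_x j] u (D2u i j)
      & \forall z \ae lebesgue_tx d, D z ->
          ut z - \sum_i \sum_j a z.1 z.2 i j * D2u i j z = 0].

(* [P^* v = 0] in the sense of distributions, i.e. [<v, P phi> = 0]. *)
Definition adjoint_solution {R : realType} {d : nat}
    (a : R -> 'rV[R]_d -> 'M[R]_d) (D : set (R * 'rV[R]_d))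
    (v : R * 'rV[R]_d -> R) : Prop :=
  locally_integrable_tx D v /\
  forall phi, test_function D phi ->
    \int[lebesgue_tx d]_(z in D)
      (v z * (iter_derive [:: dir_t] phi z -
         \sum_i \sum_j a z.1 z.2 i j * iter_derive [:: dir_x i; dir_x j] phi z))
    = 0.

(* The library's [ess_inf], relative to a subset. *)
Definition ess_inf_on {R : realType} {d : nat} (A : set (R * 'rV[R]_d))
    (u : R * 'rV[R]_d -> R) : \bar R :=
  ereal_sup [set y | \forall z \ae lebesgue_tx d, A z -> (y <= (u z)%:E)%E].

Definition weak_harnack {R : realType} {d : nat}
    (a : R -> 'rV[R]_d -> 'M[R]_d) (R0 N0 : R) : Prop :=
  forall (t0 : R) (x0 : 'rV[R]_d) (r : R) (u : R * 'rV[R]_d -> R),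
    0 < r < R0 ->
    (forall z, cylinder t0 x0 (2 * r) z -> 0 <= u z) ->
    adjoint_solution a (cylinder t0 x0 (2 * r)) u ->
    (((r ^+ 2 * fine (lebesgue_rV d (eball x0 r)))^-1)%:E *
       \int[lebesgue_measure]_(t in `[(t0 + 2 * r ^+ 2)%R, (t0 + 3 * r ^+ 2)%R])
         \int[lebesgue_rV d]_(x in eball x0 r) (u (t, x))%:E
     <= N0%:E * ess_inf_on (cylinder t0 x0 r) u)%E.

(* The value at time [tau] of the solution of the Cauchy problem in
   [(tau, oo) x R^d] is understood as a limit at the continuity points of [f];
   this is all of [R^d] when [f] is continuous. *)
Record fundamental_solution {R : realType} {d : nat}
    (a : R -> 'rV[R]_d -> 'M[R]_d)
    (Gamma : R -> 'rV[R]_d -> R -> 'rV[R]_d -> R) : Prop := {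
  fundamental_ge0 : forall t x s y, 0 <= Gamma t x s y ;
  fundamental_past : forall t x s y, t < s -> Gamma t x s y = 0 ;
  fundamental_equation : forall s y,
    solution a (`]s, +oo[ `*` setT) (fun z => Gamma z.1 z.2 s y) ;
  fundamental_dirac : forall s y (phi : 'rV[R]_d -> R),
    test_function setT phi ->
    \int[lebesgue_rV d]_x (Gamma t x s y * phi x) @[t --> s^'+] --> phi y ;
  fundamental_cauchy : forall (tau : R) (f : 'rV[R]_d -> R),
    measurable_fun setT f -> (exists M : R, forall z, `|f z| <= M) ->
    let u (z : R * 'rV[R]_d) :=
      \int[lebesgue_rV d]_y (Gamma z.1 z.2 tau y * f y) in
    [/\ forall t x, tau < t ->
          (lebesgue_rV d).-integrable setT (fun y => (Gamma t x tau y * f y)%:E),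
        solution a (`]tau, +oo[ `*` setT) u,
        exists M : R, forall t x, tau < t -> `|u (t, x)| <= M
      & forall x, {for x, continuous f} ->
          u @ within (`]tau, +oo[ `*` setT) (nbhs (tau, x)) --> f x] ;
  fundamental_adjoint : forall t x,
    adjoint_solution a (`]-oo, t[ `*` setT) (fun z => Gamma t x z.1 z.2)
}.

(* Adjoint solutions are determined up to null sets.  This is the value at
   [(s, y)] of the usual representative, obtained from averages over shrinking
   parabolic cylinders; the averages converge to [v (s, y)] at almost every
   [(s, y)], and the lower limit is taken where they do not converge. *)
Definition representative {R : realType} {d : nat} (v : R * 'rV[R]_d -> R)
    (s : R) (y : 'rV[R]_d) : \bar R :=
  limf_einf (fun rho : R =>
    let Q := `]s - rho ^+ 2, s + rho ^+ 2[ `*` eball y rho in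
    (((fine (lebesgue_tx d Q))^-1)%:E *
       \int[lebesgue_tx d]_(z in Q) (v z)%:E)%E) (0 : R)^'+.

(* Main.v *)
Require Import Defs.
From mathcomp Require Import all_boot all_order all_algebra.
From mathcomp Require Import all_classical all_reals all_analysis.
From mathcomp Require Import measurable_realfun.
From mathcomp Require Import ring lra.
Set Implicit Arguments.
Unset Strict Implicit.
Unset Printing Implicit Defensive.

(** Fix [(t, x)].  As a function of [(s, z)], the kernel [Gamma t x s z] is a
nonnegative adjoint solution before time [t].  With [r ^ 2 = (t - s) / 4], the
weak Harnack inequality bounds it from below near [(s, y)] by [1 / (N0 |B_r|)]
times the average, over an interval of later times [tau], of the mass that
[Gamma t x tau] gives to the ball [B_r(y)] ([harnack_ball_mass]).  The
inequality is used only once, so [N0] enters the prefactor and not the exponent,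
as soon as this mass is at least [exp (- C - |x - y|^2 / (kappa (t - s)))] with
[C] and [kappa] depending on [d], [lambda] and [Lambda] only ([ball_mass_ge]).

That mass is the value at [(t, x)] of the solution of the Cauchy problem that
starts at time [tau] from the indicator function of [B_r(y)].  It is compared
with an explicit smooth subsolution, supported in a moving ball of radius [r]
which rests at [y] during the averaging interval and then travels to [x].  The
damping factor [exp (- b s)] that makes it a subsolution has
[b = speed^2 / lambda + C / r^2] ([barrier_subsolution]); a speed of order
[|x - y| / (t - s)] gives exactly the Gaussian exponent.

The comparison ([comparison]) does not go through a maximum principle, which
fails in general when second derivatives are only locally integrable.  It
comes from the adjoint equation.  Let [w] be a subsolution with compact support
in space and put [J s := int Gamma t x s z w(s, z) dz].  Testing the adjoint
equation with [eta(s) w(s, z)], where [eta] is a smoothed indicator function of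
an interval, shows that [J] is nonincreasing off a null set
([adjoint_monotone]).  Let [s < s'] lie outside the union of these null sets
over the rational points [(t, x)].  In [J s >= J s'] let [(t, x)] tend to
[(s', x0)] from above: by continuity the left-hand side tends to its value at
[(s', x0)], and the right-hand side, whose initial value at time [s'] is
[w(s', .)], tends to [w(s', x0)].

Every point thus has a neighbourhood on which the kernel is almost everywhere
above the bound at that point, up to a constant factor.  A countable family of
such neighbourhoods gives the bound almost everywhere, and averaging over small
cylinders gives it for the representative. *)

Import Order.TTheory GRing.Theory Num.Theory.
Import numFieldTopology.Exports numFieldNormedType.Exports.

Local Open Scope classical_set_scope.
Local Open Scope ring_scope.

(** * Smoothness of functions given by a formula *)

(** The derivatives are carried as an explicit sequence: for the functions used
here, such as the flat function below, a closed formula for all of them is what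
one proves anyway. *)
Definition smooth1 {R : realType} (F : R -> R) :=
  exists2 G : nat -> R -> R, G 0%N = F & forall n (x : R), is_derive x (1 : R) (G n) (G n.+1 x).

(** This class is stable under directional derivatives, so that its members are
smooth in the sense of [smooth] although that predicate itself, which
quantifies over lists of directions, has no direct induction for products and
compositions. *)
Inductive elementary {R : realType} {V I : Type} (c : I -> V -> R) : (V -> R) -> Prop :=
| elementary_cst k : elementary c (fun=> k)
| elementary_coord i : elementary c (c i)
| elementary_add f g : elementary c f -> elementary c g -> elementary c (fun z => f z + g z)
| elementary_mul f g : elementary c f -> elementary c g -> elementary c (fun z => f z * g z)
| elementary_comp F f : smooth1 F -> elementary c f -> elementary c (fun z => F (f z)).

Section smooth1.
Context {R : realType}.
Implicit Types F : R -> R.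

Lemma smooth1_derive F : smooth1 F ->
  smooth1 (derive1 F) /\ forall x, is_derive x (1 : R) F (derive1 F x).
Proof.
move=> [G G0 dG].
have dF x : is_derive x (1 : R) F (G 1%N x) by rewrite -G0; exact: dG.
have F1 : derive1 F = G 1%N.
  by apply/funext => x; rewrite derive1E; exact: derive_val.
split; last by move=> x; rewrite F1.
by exists (fun n => G n.+1) => // n x; exact: dG.
Qed.

End smooth1.

Section chain.
Context {R : realType} {V : normedModType R}.

Lemma differentiable_comp1 (F : R -> R) (g : V -> R) x dF :
  is_derive (g x) (1 : R) F dF -> differentiable g x ->
  differentiable (fun z => F (g z)) x /\
  forall v, 'D_v (fun z => F (g z)) x = dF * 'D_v g x.
Proof.
move=> [/derivable1_diffP dF1 dFE] dg; split.
  exact: differentiable_comp.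
move=> v; rewrite deriveE; last exact: differentiable_comp.
rewrite (diff_comp dg dF1)/= -dFE !deriveE//.
have {1}-> : 'd g x v = ('d g x v) *: (1 : R) by rewrite [_%:A]mulr1.
by rewrite linearZ /= mulrC.
Qed.

Lemma derive_add (f g : V -> R) x v : differentiable f x -> differentiable g x ->
  'D_v (fun z => f z + g z) x = 'D_v f x + 'D_v g x.
Proof. by move=> df dg; apply: deriveD; exact: diff_derivable. Qed.

Lemma derive_mul (f g : V -> R) x v : differentiable f x -> differentiable g x ->
  'D_v (fun z => f z * g z) x = f x * 'D_v g x + g x * 'D_v f x.
Proof. by move=> df dg; apply: deriveM; exact: diff_derivable. Qed.

End chain.

Section elementary.
Context {R : realType} {V : normedModType R} {I : Type} (c : I -> V -> R).
Hypothesis c_diff : forall i x, differentiable (c i) x.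
Hypothesis c_lin : forall i v, exists k, forall x, 'D_v (c i) x = k.

Lemma elementary_differentiable f : elementary c f -> forall x, differentiable f x.
Proof.
elim=> [k|i|{}f g _ df _ dg|{}f g _ df _ dg|F {}f [G <- dG] _ df] x.
- exact: differentiable_cst.
- exact: c_diff.
- exact: differentiableD.
- exact: differentiableM.
- by have [] := differentiable_comp1 (dG 0%N (f x)) (df x).
Qed.

Lemma elementary_derive f v : elementary c f -> elementary c ('D_v f).
Proof.
elim=> [k|i|{}f g ef df eg dg|{}f g ef df eg dg|F {}f sF ef df].
- rewrite (_ : 'D_v _ = fun=> 0); first exact: elementary_cst.
  by apply/funext => x; exact: derive_cst.
- have [k ck] := c_lin i v.
  rewrite (_ : 'D_v _ = fun=> k); first exact: elementary_cst.
  by apply/funext => x; exact: ck.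
- rewrite (_ : 'D_v _ = fun z => 'D_v f z + 'D_v g z); first exact: elementary_add.
  by apply/funext => x; apply: derive_add; exact: elementary_differentiable.
- rewrite (_ : 'D_v _ = fun z => f z * 'D_v g z + g z * 'D_v f z).
    by apply: elementary_add; exact: elementary_mul.
  by apply/funext => x; apply: derive_mul; exact: elementary_differentiable.
- have [sF1 dF] := smooth1_derive sF.
  rewrite (_ : 'D_v _ = fun z => derive1 F (f z) * 'D_v f z).
    by apply: elementary_mul => //; exact: elementary_comp.
  apply/funext => x.
  by have [_ ->] := differentiable_comp1 (dF (f x)) (elementary_differentiable ef x).
Qed.

Lemma elementary_smooth f : elementary c f -> smooth f.
Proof.
move=> ef vs; have {ef} : elementary c (iter_derive vs f).
  by elim: vs => [//|v vs IH]; exact: elementary_derive.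
move: (iter_derive vs f) => g eg; split.
- by move=> x; exact/differentiable_continuous/elementary_differentiable.
- by move=> x v; exact/diff_derivable/elementary_differentiable.
Qed.

Lemma elementary_opp f : elementary c f -> elementary c (fun z => - f z).
Proof.
move=> ef; rewrite (_ : (fun z => _) = fun z => (-1) * f z).
  by apply: elementary_mul => //; exact: elementary_cst.
by apply/funext => z; rewrite mulN1r.
Qed.

Lemma elementary_sum n (F : 'I_n -> V -> R) : (forall i, elementary c (F i)) ->
  elementary c (fun z => \sum_i F i z).
Proof.
elim: n F => [|n IH] F eF.
  rewrite (_ : (fun z => _) = fun=> 0); first exact: elementary_cst.
  by apply/funext => z; rewrite big_ord0.
rewrite (_ : (fun z => _) = fun z => F ord0 z + \sum_(i < n) F (lift ord0 i) z).
  apply: elementary_add => //; apply: IH => i; exact: eF.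
by apply/funext => z; rewrite big_ord_recl.
Qed.

End elementary.

Lemma elementary_smooth1 {R : realType} (F : R -> R) :
  elementary (fun (_ : unit) (x : R) => x) F -> smooth1 F.
Proof.
move=> eF; exists (fun n => iter n (fun g : R -> R => 'D_(1 : R) g) F) => // n x.
apply/derivableP/diff_derivable.
apply: (@elementary_differentiable _ _ unit (fun _ x => x)).
  move=> _ y. by have [] := is_diff_id y.
elim: n => [//|n IH] /=; apply: elementary_derive => //.
by move=> _ v; exists v => y; exact: derive_id.
Qed.

(** * A flat function and a smooth step *)

Section flat.
Context {R : realType}.
Implicit Types (p : {poly R}) (x : R).

(** The functions [p(1/x) exp(-1/x)] form a family that contains [exp(-1/x)] and
is stable under derivation; this is why a polynomial [p] is a parameter. *)
Definition flat p x : R := if 0 < x then p.[x^-1] * expR (- x^-1) else 0.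

Lemma flat_le0 p x : x <= 0 -> flat p x = 0.
Proof. by rewrite /flat leNgt => /negbTE->. Qed.

Lemma flat_gt0 p x : 0 < x -> flat p x = p.[x^-1] * expR (- x^-1).
Proof. by rewrite /flat => ->. Qed.

(** The power series of [expR] has nonnegative terms, so it dominates each of
them. *)
Lemma exprn_expRN_le k (y : R) : 0 <= y -> y ^+ k * expR (- y) <= k`!%:R.
Proof.
move=> y0; rewrite expRN ler_pdivrMr ?expR_gt0//.
case: k => [|k]; first by rewrite expr0 fact0 mul1r -expR0 ler_expR.
have := expR_ge1Dxn k y0 => h.
rewrite mulrC -ler_pdivrMr ?ltr0n ?fact_gt0//.
by apply: le_trans h; rewrite lerDr.
Qed.

(** The bound is quadratic so that the difference quotients at [0] tend to [0]. *)
Lemma flat_quadratic p : exists2 C : R, 0 <= C & forall x, `|flat p x| <= C * x ^+ 2.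
Proof.
exists (\sum_(i < size p) `|p`_i| * (i.+2)`!%:R).
  by apply: sumr_ge0 => i _; rewrite mulr_ge0.
move=> x; have [x0|x0] := leP x 0.
  rewrite flat_le0// normr0 mulr_ge0 ?sqr_ge0//.
  by apply: sumr_ge0 => i _; rewrite mulr_ge0.
rewrite flat_gt0// horner_coef mulr_suml mulr_suml.
apply: (le_trans (ler_norm_sum _ _ _)); apply: ler_sum => i _.
rewrite -!mulrA normrM ler_wpM2l// ger0_norm; last first.
  by rewrite mulr_ge0 ?expR_ge0// exprn_ge0// invr_ge0 ltW.
have := @exprn_expRN_le i.+2 x^-1; rewrite invr_ge0 (ltW x0) => /(_ isT).
rewrite -ler_pdivrMr ?exprn_gt0//; apply: le_trans.
by rewrite -[i.+2]addn2 exprD mulrAC (exprVn x 2).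
Qed.

(** With [u = 1/x], one has [d/dx = - u^2 d/du], and [p(u) exp(-u)] has
[u]-derivative [(p' - p)(u) exp(-u)]. *)
Definition flat_deriv p : {poly R} := 'X^2 * (p - p^`()).

Lemma flat_is_derive p x : is_derive x (1 : R) (flat p) (flat (flat_deriv p) x).
Proof.
have [x0|x0|->] := ltgtP x 0.
- rewrite (flat_le0 _ (ltW x0)).
  apply: (@near_eq_is_derive _ _ _ (cst 0)).
  by near=> y; rewrite flat_le0//; apply: ltW; near: y; exact: lt_nbhsl.
- rewrite flat_gt0//.
  apply: (@near_eq_is_derive _ _ _ (fun y : R => p.[y^-1] * expR (- y^-1))).
  + near=> y; rewrite flat_gt0//; near: y; exact: lt_nbhsr.
  + have dV : is_derive x (1 : R) (fun y : R => y^-1) (- x ^- 2).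
      have x1 : x != 0 by rewrite gt_eqF.
      split; first exact: (@derivableV _ _ id).
      by rewrite (@deriveV _ _ id)// derive_id [_%:A]mulr1.
    have dp : is_derive x (1 : R) (fun y : R => p.[y^-1]) (p^`().[x^-1] * - x ^- 2).
      exact: (@is_derive1_comp _ (horner p) (fun y : R => y^-1)).
    have dN : is_derive x (1 : R) (fun y : R => - y^-1) (x ^- 2).
      by have := is_deriveN dV; rewrite opprK.
    have dE : is_derive x (1 : R) (fun y : R => expR (- y^-1)) (expR (- x^-1) * x ^- 2).
      exact: (@is_derive1_comp _ expR (fun y : R => - y^-1)).
    apply: (is_derive_eq (is_deriveM dp dE)).
    rewrite /flat_deriv hornerM hornerXn hornerD hornerN exprVn.
    rewrite /GRing.scale/=; ring.
- rewrite flat_le0//.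
  have [C C0 hC] := flat_quadratic p.
  have h : (fun h : R => h^-1 *: ((flat p \o shift 0) (h *: 1) - flat p 0)) @ 0^' --> (0 : R).
    apply/cvgr0Pnorm_le => e e0; near=> k.
    rewrite /= addr0 (flat_le0 _ (lexx 0)) subr0 [k%:A]mulr1 normrZ normfV.
    have k0 : 0 < `|k| by rewrite normr_gt0; near: k; exact: nbhs_dnbhs_neq.
    rewrite ler_pdivrMl//; apply: (le_trans (hC _)).
    rewrite -real_normK ?num_real// expr2 mulrA [leRHS]mulrC ler_wpM2r//.
    have : `|k| <= e / (C + 1).
      near: k; apply: dnbhs0_le; rewrite divr_gt0//; exact: ltr_wpDl.
    rewrite ler_pdivlMr; last exact: ltr_wpDl.
    apply: le_trans; rewrite mulrDr mulr1 mulrC lerDl; exact: ltW.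
  split; first by apply/cvg_ex; exists 0.
  by apply: cvg_lim.
Unshelve. all: by end_near. Qed.

Lemma flat_smooth1 p : smooth1 (flat p).
Proof.
exists (fun n => flat (iter n flat_deriv p)) => // n x.
exact: flat_is_derive.
Qed.

Lemma expR_smooth1 : smooth1 (@expR R).
Proof. by exists (fun=> expR) => // n x; exact: is_derive_expR. Qed.

Definition cutoff : R -> R := flat 1.
Definition cutoff1 : R -> R := flat 'X^2.
Definition cutoff2 : R -> R := flat ('X^4 - 'X^3 *+ 2).

Lemma cutoff_le0 x : x <= 0 -> cutoff x = 0.
Proof. exact: flat_le0. Qed.

Lemma cutoffE x : 0 < x -> cutoff x = expR (- x^-1).
Proof. by move=> x0; rewrite /cutoff flat_gt0// hornerC mul1r. Qed.

Lemma cutoff1E x : 0 < x -> cutoff1 x = x ^- 2 * expR (- x^-1).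
Proof. by move=> x0; rewrite /cutoff1 flat_gt0// hornerXn exprVn. Qed.

Lemma cutoff2E x : 0 < x -> cutoff2 x = (x^-1 ^+ 4 - x^-1 ^+ 3 *+ 2) * expR (- x^-1).
Proof. by move=> x0; rewrite /cutoff2 flat_gt0// hornerD hornerN hornerMn !hornerXn. Qed.

Lemma is_derive_cutoff x : is_derive x (1 : R) cutoff (cutoff1 x).
Proof.
have := flat_is_derive 1 x; rewrite /flat_deriv -polyC1 derivC subr0 mulr1.
by [].
Qed.

Lemma is_derive_cutoff1 x : is_derive x (1 : R) cutoff1 (cutoff2 x).
Proof.
have := flat_is_derive 'X^2 x; rewrite /flat_deriv derivXn/= expr1.
rewrite (_ : _ * _ = 'X^4 - 'X^3 *+ 2)//.
by ring.
Qed.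

Lemma cutoff_ge0 x : 0 <= cutoff x.
Proof.
have [x0|x0] := leP x 0; first by rewrite cutoff_le0.
by rewrite cutoffE// expR_ge0.
Qed.

Lemma cutoff_gt0 x : 0 < x -> 0 < cutoff x.
Proof. by move=> x0; rewrite cutoffE// expR_gt0. Qed.

Lemma cutoff_le1 x : cutoff x <= 1.
Proof.
have [x0|x0] := leP x 0; first by rewrite cutoff_le0.
by rewrite cutoffE// expR_le1 oppr_le0 invr_ge0 ltW.
Qed.

Lemma cutoff1_ge0 x : 0 <= cutoff1 x.
Proof.
have [x0|x0] := leP x 0; first by rewrite /cutoff1 flat_le0.
by rewrite cutoff1E// mulr_ge0 ?expR_ge0// invr_ge0 sqr_ge0.
Qed.

Lemma cutoff_nondecreasing : {homo cutoff : x y / x <= y}.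
Proof.
move=> x y xy; have [x0|x0] := leP x 0; first by rewrite cutoff_le0 ?cutoff_ge0.
have y0 := lt_le_trans x0 xy.
by rewrite !cutoffE// ler_expR lerN2 lef_pV2.
Qed.

(** Only compositions of [cutoff] are used: [cutoff 1 - cutoff x] becomes
nonpositive exactly when [1 <= x] and is constant for [x <= 0], so that the
outer [cutoff] makes [step] constant on both sides. *)
Definition step x : R := 1 - cutoff (cutoff 1 - cutoff x) / cutoff (cutoff 1).
Definition step1 x : R := cutoff1 (cutoff 1 - cutoff x) * cutoff1 x / cutoff (cutoff 1).

Lemma step_le0 x : x <= 0 -> step x = 0.
Proof.
move=> x0; rewrite /step (cutoff_le0 x0) subr0 divff ?subrr//.
by rewrite gt_eqF// cutoff_gt0// cutoff_gt0.
Qed.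

Lemma step_ge1 x : 1 <= x -> step x = 1.
Proof.
move=> x1; rewrite /step (@cutoff_le0 (_ - _)) ?mul0r ?subr0//.
by rewrite subr_le0 cutoff_nondecreasing.
Qed.

Let bb0 : 0 < cutoff (cutoff 1).
Proof. by rewrite cutoff_gt0// cutoff_gt0. Qed.

Lemma step_nondecreasing : {homo step : x y / x <= y}.
Proof.
move=> x y xy; rewrite /step lerD2l lerN2 ler_pM2r ?invr_gt0//.
by apply: cutoff_nondecreasing; rewrite lerD2l lerN2; exact: cutoff_nondecreasing.
Qed.

Lemma step_ge0 x : 0 <= step x.
Proof.
have [x0|x0] := leP x 0; first by rewrite step_le0.
by rewrite -(step_le0 (lexx 0)); apply/step_nondecreasing/ltW.
Qed.

Lemma step_le1 x : step x <= 1.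
Proof.
have [x0|x0] := leP 1 x; first by rewrite step_ge1.
by rewrite -[leRHS](step_ge1 (lexx 1)); apply/step_nondecreasing/ltW.
Qed.

Lemma step1_ge0 x : 0 <= step1 x.
Proof. by rewrite /step1 divr_ge0 ?(ltW bb0)// mulr_ge0 ?cutoff1_ge0. Qed.

Lemma step1_le0 x : x <= 0 -> step1 x = 0.
Proof. by move=> x0; rewrite /step1 [cutoff1 x]flat_le0// mulr0 mul0r. Qed.

Lemma step1_ge1 x : 1 <= x -> step1 x = 0.
Proof.
move=> x1; rewrite /step1 [cutoff1 (_ - _)]flat_le0 ?mul0r//.
by rewrite subr_le0 cutoff_nondecreasing.
Qed.

Let gen := elementary (fun (_ : unit) (x : R) => x).

Let gen_cutoff1 : gen cutoff1.
Proof. by apply: (@elementary_comp _ _ _ _ cutoff1 _); [exact: flat_smooth1|exact: (@elementary_coord _ _ _ (fun (_ : unit) (x : R) => x) tt)]. Qed.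

Let gen_cutoff : gen cutoff.
Proof. by apply: (@elementary_comp _ _ _ _ cutoff _); [exact: flat_smooth1|exact: (@elementary_coord _ _ _ (fun (_ : unit) (x : R) => x) tt)]. Qed.

Let gen_cutoffN : gen (fun x => cutoff 1 - cutoff x).
Proof.
apply: elementary_add; first exact: elementary_cst.
exact: (elementary_opp gen_cutoff).
Qed.

Lemma step_smooth1 : smooth1 step.
Proof.
apply: elementary_smooth1; apply: elementary_add; first exact: elementary_cst.
apply: elementary_opp; apply: elementary_mul; last exact: elementary_cst.
apply: (@elementary_comp _ _ _ _ cutoff); [exact: flat_smooth1|exact: gen_cutoffN].
Qed.

Lemma step1_smooth1 : smooth1 step1.
Proof.
apply: elementary_smooth1; apply: elementary_mul; last exact: elementary_cst.
apply: elementary_mul => //.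
apply: (@elementary_comp _ _ _ _ cutoff1); [exact: flat_smooth1|exact: gen_cutoffN].
Qed.

Lemma is_derive_step x : is_derive x (1 : R) step (step1 x).
Proof.
have d1 : is_derive x (1 : R) (fun y : R => cutoff 1 - cutoff y) (- cutoff1 x).
  by apply: (is_derive_eq (is_deriveB (is_derive_cst (cutoff 1) x _) (is_derive_cutoff x))); rewrite sub0r.
have d2 := @is_derive1_comp _ cutoff (fun y : R => cutoff 1 - cutoff y) _ _ _ (is_derive_cutoff _) d1.
have d3 := is_deriveM d2 (is_derive_cst (cutoff (cutoff 1))^-1 x _).
have -> : step = cst 1 - (cutoff \o (fun y : R => cutoff 1 - cutoff y)) * cst (cutoff (cutoff 1))^-1 by [].
have d4 := is_deriveB (is_derive_cst (1:R) x (1:R)) d3. apply: (is_derive_eq d4).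
by rewrite /step1 /GRing.scale /=; ring.
Qed.

Lemma smooth1_continuous F : smooth1 F -> continuous (F : R -> R).
Proof.
move=> /smooth1_derive[_ dF] x; apply/differentiable_continuous/derivable1_diffP.
by have [] := dF x.
Qed.

Lemma step1_bounded : exists2 C : R, 0 < C & forall x, step1 x <= C.
Proof.
have [c _ hc] := @EVT_max R step1 0 1 ler01 (continuous_subspaceT (smooth1_continuous step1_smooth1)).
exists (step1 c + 1) => [|x]; first by rewrite ltr_wpDl ?step1_ge0.
have [x0|x0] := leP x 0; first by rewrite step1_le0// addr_ge0 ?step1_ge0.
have [x1|x1] := leP 1 x; first by rewrite step1_ge1// addr_ge0 ?step1_ge0.
by rewrite ler_wpDr// hc// in_itv/= !ltW.
Qed.

End flat.

(** * Functions of time and space given by a formula *)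

Section coord.
Context {R : realType} {d : nat}.
Notation V := (R * 'rV[R]_d)%type.

Definition tx_coord (i : option 'I_d) (z : V) : R :=
  if i is Some j then z.2 ord0 j else z.1.

Lemma tx_coord_lin i (k : R) (z v : V) :
  tx_coord i (k *: v + z) = k * tx_coord i v + tx_coord i z.
Proof. by case: i => [j|]//=; rewrite !mxE. Qed.

(** The difference quotients of a linear form are constant. *)
Lemma is_derive_tx_coord i (z v : V) : is_derive z v (tx_coord i) (tx_coord i v).
Proof.
have h : (fun h : R => h^-1 *: ((tx_coord i \o shift z) (h *: v) - tx_coord i z)) @ 0^' --> tx_coord i v.
  apply: cvg_near_cst; near=> k.
  rewrite /= tx_coord_lin addrK /GRing.scale/= mulKf//.
  by near: k; exact: nbhs_dnbhs_neq.
split; first by apply/cvg_ex; exists (tx_coord i v).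
by apply/cvg_lim: h; exact: norm_hausdorff.
Unshelve. all: by end_near. Qed.

Lemma tx_coord_differentiable i (z : V) : differentiable (tx_coord i) z.
Proof.
case: i => [j|]; last by apply: (@linear_differentiable _ _ _ fst) => ?; exact: cvg_fst.
rewrite (_ : tx_coord _ = (fun v : 'rV[R]_d => v ord0 j) \o snd)//.
apply: differentiable_comp; first by apply: (@linear_differentiable _ _ _ snd) => ?; exact: cvg_snd.
exact: differentiable_coord.
Qed.

Lemma tx_coord_derive i (v : V) : exists k, forall z, 'D_v (tx_coord i) z = k.
Proof.
exists (tx_coord i v) => z.
by have [] := is_derive_tx_coord i z v.
Qed.

Definition elementary_tx := @elementary R V (option 'I_d) tx_coord.

Lemma elementary_tx_differentiable f : elementary_tx f -> forall z, differentiable f z.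
Proof. exact: (elementary_differentiable tx_coord_differentiable). Qed.

Lemma elementary_tx_continuous f : elementary_tx f -> continuous (f : V -> R).
Proof. by move=> gf z; apply/differentiable_continuous/elementary_tx_differentiable. Qed.

Lemma elementary_tx_derive f v : elementary_tx f -> elementary_tx ('D_v f).
Proof. exact: (elementary_derive tx_coord_differentiable tx_coord_derive). Qed.

Lemma elementary_tx_smooth f : elementary_tx f -> smooth (f : V -> R).
Proof. exact: (elementary_smooth tx_coord_differentiable tx_coord_derive). Qed.

(** The sigma-algebra on row vectors is generated by the coordinates and is not
presented as the Borel one, so measurability follows the construction of the
function instead of its continuity. *)
Lemma elementary_tx_measurable f : elementary_tx f ->
  measurable_fun [set: measurableTypeR R * 'rV[R]_d] f.
Proof.
elim=> [k|[j|]|{}f g _ df _ dg|{}f g _ df _ dg|F {}f sF _ df].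
- exact: measurable_cst.
- rewrite (_ : tx_coord _ = rV_coord j \o snd)//.
  apply: measurableT_comp; first exact: measurable_rV_coord.
  exact: measurable_snd.
- exact: measurable_fst.
- exact: measurable_funD.
- exact: measurable_funM.
- have mF : measurable_fun [set: measurableTypeR R] (F : measurableTypeR R -> measurableTypeR R).
    by apply: continuous_measurable_fun; exact: smooth1_continuous.
  exact: (measurableT_comp mF df).
Qed.

End coord.

(** * The Lebesgue measure of Euclidean balls *)

Section euclid.
Context {R : realType} {d : nat}.
Implicit Types (x y : 'rV[R]_d) (r : R).

Definition cube x r : set 'rV[R]_d := [set v | forall i, `|v ord0 i - x ord0 i| < r].
Definition closed_box r : set 'rV[R]_d := [set v | forall i, `|v ord0 i| <= r].

Lemma measurable_coord_fun i : measurable_fun [set: 'rV[R]_d] (fun v : 'rV[R]_d => v ord0 i).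
Proof. exact: measurable_rV_coord. Qed.

Lemma measurable_forall_coord (A : 'I_d -> set R) : (forall i, measurable (A i)) ->
  measurable [set v : 'rV[R]_d | forall i, A i (v ord0 i)].
Proof.
move=> mA; rewrite (_ : mkset _ = \bigcap_(i in [set: 'I_d]) ((fun v : 'rV[R]_d => v ord0 i) @^-1` A i)).
  apply: fin_bigcap_measurable => // i _; rewrite -[X in measurable X]setTI.
  exact: measurable_coord_fun.
by apply/seteqP; split=> v /= h i => [_|]; exact: h.
Qed.

Lemma measurable_cube x r : measurable (cube x r).
Proof.
rewrite (_ : cube x r = [set v : 'rV[R]_d | forall i, ball (x ord0 i) r (v ord0 i)]).
  by apply: (@measurable_forall_coord (fun i => ball (x ord0 i) r)) => i; exact: measurable_ball.
by apply/seteqP; split => u /= h i; have := h i; rewrite /ball/= distrC.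
Qed.

Lemma measurable_closed_box r : measurable (closed_box r).
Proof.
rewrite (_ : closed_box r = [set v : 'rV[R]_d | forall i, `[- r, r]%classic (v ord0 i)]).
  by apply: (@measurable_forall_coord (fun=> `[- r, r]%classic)) => i; exact: measurable_itv.
by apply/seteqP; split=> v h i; have := h i; rewrite /= in_itv/= ler_norml.
Qed.

Lemma measurable_enorm y : measurable_fun [set: 'rV[R]_d] (fun v => enorm (v - y)).
Proof.
apply: (@measurableT_comp _ _ _ _ _ _ (@Num.sqrt R)).
  by apply: continuous_measurable_fun; exact: sqrt_continuous.
apply: measurable_sum => i; apply: measurable_funX.
rewrite (_ : (fun _ => _) = (fun v : 'rV[R]_d => v ord0 i - y ord0 i)); last first.
  by apply/funext => v; rewrite !mxE.
by apply: measurable_funB; [exact: measurable_coord_fun|exact: measurable_cst].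
Qed.

Lemma measurable_eball x r : measurable (eball x r).
Proof.
rewrite (_ : eball x r = (fun v => enorm (v - x)) @^-1` `]-oo, r[); last first.
  by apply/seteqP; split => v /=; rewrite in_itv.
rewrite -[X in measurable X]setTI; apply: measurable_enorm => //.
Qed.

Lemma enorm_ge0 x : 0 <= enorm x. Proof. exact: sqrtr_ge0. Qed.

Lemma sqr_enorm x : enorm x ^+ 2 = \sum_i x ord0 i ^+ 2.
Proof. by rewrite sqr_sqrtr// sumr_ge0// => i _; exact: sqr_ge0. Qed.

Lemma norm_coord_le_enorm x i : `|x ord0 i| <= enorm x.
Proof.
rewrite -sqrtr_sqr ler_wsqrtr// (bigD1 i)//= lerDl.
by apply: sumr_ge0 => j _; exact: sqr_ge0.
Qed.

Lemma eball_subset_cube x r : eball x r `<=` cube x r.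
Proof.
move=> v h i; apply: le_lt_trans h.
by have := norm_coord_le_enorm (v - x) i; rewrite !mxE.
Qed.

Lemma enorm_lt x r : 0 < r -> (enorm x < r) = (\sum_i x ord0 i ^+ 2 < r ^+ 2).
Proof. by move=> r0; rewrite -sqr_enorm ltr_sqr ?nnegrE ?enorm_ge0// ltW. Qed.

(** The crude factor [d + 1] replaces the optimal [sqrt d]: it is needed only
for the positivity of the measure of balls, and it makes sense for [d = 0]. *)
Lemma cube_subset_eball x r : 0 < r -> cube x (r / d.+1%:R) `<=` eball x r.
Proof.
move=> r0 v h; rewrite /eball/= enorm_lt//.
have d0 : 0 < d.+1%:R :> R by [].
apply: (@le_lt_trans _ _ (\sum_(i < d) (r / d.+1%:R) ^+ 2)).
  apply: ler_sum => i _; rewrite -[leLHS]real_normK ?num_real//.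
  rewrite ler_sqr ?nnegrE//; last by rewrite divr_ge0// ltW.
  by have := h i; rewrite !mxE => /ltW.
rewrite sumr_const card_ord -[ltLHS]mulr_natr expr_div_n -mulrA -[ltRHS]mulr1 ltr_pM2l ?exprn_gt0//.
rewrite mulrC ltr_pdivrMr ?exprn_gt0// mul1r -natrX ltr_nat.
by rewrite expnS expn1 mulSn; apply: (@leq_trans d.+1) => //; rewrite leq_addr.
Qed.

End euclid.

(** The measure is a product with one more factor [lebesgue_measure] per
dimension, and a cube is the product of an interval and a lower-dimensional
cube. *)
Lemma lebesgue_rV_cube {R : realType} (d : nat) (x : 'rV[R]_d) (r : R) : 0 < r ->
  lebesgue_rV d (cube x r) = ((2 * r) ^+ d)%:E.
Proof.
move=> r0; elim: d x => [|d IH] x.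
  rewrite /= expr0 diracE mem_set// => -[]//.
rewrite /= /pushforward.
set x' : 'rV[R]_d := \row_j x ord0 (lift ord0 j).
have -> : rV_cons @^-1` cube x r = ball (x ord0 ord0) r `*` cube x' r.
  apply/seteqP; split => -[u v] /=.
    move=> h; split => /=.
      by have := h ord0; rewrite /rV_cons mxE unlift_none /ball/= distrC.
    by move=> j; have := h (lift ord0 j); rewrite /rV_cons !mxE liftK.
  move=> [/= hu hv] i; case: (unliftP ord0 i) => [j ->|->].
    by have := hv j; rewrite /rV_cons !mxE liftK.
  by move: hu; rewrite /rV_cons mxE unlift_none /ball/= distrC.
rewrite product_measure1E//; [|exact: measurable_ball|exact: measurable_cube].
rewrite IH [X in (X * _)%E](_ : _ = (r *+ 2)%:E); last by apply: lebesgue_measure_ball; exact: ltW.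
by rewrite -EFinM exprS mulr_natl.
Qed.

Section eball_measure.
Context {R : realType} {d : nat}.
Implicit Types (x y : 'rV[R]_d) (r : R).

Lemma lebesgue_rV_eball_le x r : 0 < r ->
  (lebesgue_rV d (eball x r) <= ((2 * r) ^+ d)%:E)%E.
Proof.
move=> r0; rewrite -(lebesgue_rV_cube x r0); apply: le_measure.
- by rewrite inE; exact: measurable_eball.
- by rewrite inE; exact: measurable_cube.
- exact: eball_subset_cube.
Qed.

Lemma lebesgue_rV_eball_gt0 x r : 0 < r -> (0 < lebesgue_rV d (eball x r))%E.
Proof.
move=> r0; have r1 : 0 < r / d.+1%:R by rewrite divr_gt0.
apply: (@lt_le_trans _ _ (lebesgue_rV d (cube x (r / d.+1%:R)))).
  by rewrite lebesgue_rV_cube// lte_fin exprn_gt0// mulr_gt0.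
apply: le_measure.
- by rewrite inE; exact: measurable_cube.
- by rewrite inE; exact: measurable_eball.
- exact: cube_subset_eball.
Qed.

Lemma lebesgue_rV_eball_fin x r : 0 < r -> lebesgue_rV d (eball x r) \is a fin_num.
Proof.
move=> r0; rewrite ge0_fin_numE//.
by apply: le_lt_trans (lebesgue_rV_eball_le x r0) _; exact: ltry.
Qed.

Lemma compact_closed_box r : compact (@closed_box R d r).
Proof.
rewrite (_ : closed_box r = [set v : 'rV[R]_d | forall i, `[- r, r]%classic (v ord0 i)]).
  by apply: (@rV_compact _ _ (fun=> `[- r, r]%classic)) => i; exact: segment_compact.
by apply/seteqP; split=> v h i; have := h i; rewrite /= in_itv/= ler_norml.
Qed.

End eball_measure.

(** * Mollification at Lebesgue points *)

Lemma integrable_bounded_mul d (T : measurableType d) (R : realType)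
    (mu : {measure set T -> \bar R}) (D : set T) (h f : T -> R) :
  measurable D -> measurable_fun D h -> [bounded h x | x in D] ->
  mu.-integrable D (EFin \o f) -> mu.-integrable D (EFin \o (fun x => h x * f x)).
Proof.
move=> mD mh bh intf; have := integrableMr mD mh bh intf.
by apply: eq_integrable => // x _; rewrite /= EFinM.
Qed.

Lemma integrable_subR d (T : measurableType d) (R : realType)
    (mu : {measure set T -> \bar R}) (D : set T) (f g : T -> R) :
  measurable D -> mu.-integrable D (EFin \o f) -> mu.-integrable D (EFin \o g) ->
  mu.-integrable D (EFin \o (fun x => f x - g x)).
Proof.
move=> mD intf intg; have := integrableB mD intf intg.
by apply: eq_integrable => // x _; rewrite /= EFinB.
Qed.

Lemma integrable_scaleR d (T : measurableType d) (R : realType)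
    (mu : {measure set T -> \bar R}) (D : set T) (k : R) (f : T -> R) :
  measurable D -> mu.-integrable D (EFin \o f) ->
  mu.-integrable D (EFin \o (fun x => k * f x)).
Proof.
move=> mD intf; have := integrableZl mD k intf.
by apply: eq_integrable => // x _; rewrite /= EFinM.
Qed.

Section mollification.
Context {R : realType}.
Local Notation leb := (@lebesgue_measure R).
Implicit Types (e s x : R).

(** An approximate identity concentrated on [(s, s + e)], that is, on one side of
[s].  It is a derivative of a rescaled [step], so that differences of two
mollifiers are derivatives of smooth bumps. *)
Definition mollifier e s x : R := step1 ((x - s) / e) / e.

Lemma mollifier_ge0 e s x : 0 < e -> 0 <= mollifier e s x.
Proof. by move=> e0; rewrite divr_ge0 ?step1_ge0// ltW. Qed.

Lemma mollifier_out e s x : 0 < e -> ~ (s < x < s + e) -> mollifier e s x = 0.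
Proof.
move=> e0 /negP; rewrite negb_and -!leNgt => /orP[h|h].
  by rewrite /mollifier step1_le0 ?mul0r// pmulr_lle0 ?invr_gt0// subr_le0.
by rewrite /mollifier step1_ge1 ?mul0r// ler_pdivlMr// mul1r lerBrDl.
Qed.

Lemma mollifier_le : exists2 C : R, 0 < C & forall e s x, 0 < e -> mollifier e s x <= C / e.
Proof.
have [C C0 hC] := @step1_bounded R; exists C => // e s x e0.
by rewrite ler_pM2r ?invr_gt0.
Qed.

Lemma is_derive_affine e s x : is_derive x (1:R) (fun y : R => (y - s) / e) e^-1.
Proof.
have -> : (fun y : R => (y - s) / e) = (id - cst s) * cst e^-1 by [].
have d1 := is_deriveM (is_deriveB (is_derive_id x (1:R)) (is_derive_cst s x (1:R))) (is_derive_cst e^-1 x (1:R)).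
by apply: (is_derive_eq d1); rewrite /GRing.scale/= mulr0 add0r subr0 mulr1.
Qed.

Lemma is_derive_step_affine e s x :
  is_derive x (1:R) (fun y : R => step ((y - s) / e)) (mollifier e s x).
Proof.
exact: (@is_derive1_comp _ (@step R) (fun y : R => (y - s) / e) _ _ _ (is_derive_step _) (is_derive_affine e s x)).
Qed.

Lemma mollifier_continuous e s : continuous (mollifier e s : R -> R).
Proof.
move=> x; apply: cvgM; last exact: cvg_cst.
apply: (@continuous_comp _ _ _ (fun y : R => (y - s) / e) (@step1 R)).
  by apply: cvgM; [apply: cvgB; [exact: cvg_id|exact: cvg_cst]|exact: cvg_cst].
exact: (smooth1_continuous step1_smooth1).
Qed.

Lemma mollifier_measurable e s D : measurable_fun D (mollifier e s).
Proof.
apply: measurable_funS (@subsetT _ D) _ => //.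
by apply: continuous_measurable_fun; exact: mollifier_continuous.
Qed.

Lemma mollifier_bounded e s (D : set R) : 0 < e -> [bounded mollifier e s x | x in D].
Proof.
have [C C0 hC] := mollifier_le; move=> e0.
exists (C / e); split; first by rewrite num_real.
move=> M hM x _ /=; rewrite ger0_norm ?mollifier_ge0//; apply: le_trans (ltW hM).
exact: hC.
Qed.

Lemma integral_mollifier e s : 0 < e -> \int[leb]_(x in `[s, s + e]) mollifier e s x = 1.
Proof.
move=> e0; have se : s < s + e by rewrite ltrDl.
pose F y := step ((y - s) / e).
have cF : continuous (F : R -> R).
  move=> x; apply/differentiable_continuous/derivable1_diffP.
  by have [] := is_derive_step_affine e s x.
rewrite /Rintegral (@continuous_FTC2 _ _ F)//.
- rewrite -EFinB /= /F subrr mul0r (step_le0 (lexx 0)) subr0 step_ge1//.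
  by rewrite [s + e]addrC addrK divff// gt_eqF.
- by apply: continuous_subspaceT; exact: mollifier_continuous.
- split.
  + by move=> x _; have [] := is_derive_step_affine e s x.
  + by apply: cvg_at_right_filter; exact: cF.
  + by apply: cvg_at_left_filter; exact: cF.
- by move=> x _; rewrite derive1E; have [] := is_derive_step_affine e s x.
Qed.

Lemma Rintegral_supp (f : R -> R) (K : set R) : (forall x, ~ K x -> f x = 0) ->
  \int[leb]_x f x = \int[leb]_(x in K) f x.
Proof.
move=> h; rewrite [RHS]Rintegral_mkcond; apply: eq_Rintegral => x _.
by rewrite patchE; case: ifPn => // /negP; rewrite inE => /h.
Qed.

Lemma mollifier_supp e s (f : R -> R) : 0 < e ->
  \int[leb]_x (mollifier e s x * f x) = \int[leb]_(x in `[s, s + e]) (mollifier e s x * f x).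
Proof.
move=> e0; apply: Rintegral_supp => x h; rewrite mollifier_out ?mul0r// => /andP[h1 h2].
by apply: h; rewrite /= in_itv/= !ltW.
Qed.

Lemma integrable_cst_itv (a b k : R) : leb.-integrable `[a, b] (EFin \o (fun=> k)).
Proof.
apply: measurable_bounded_integrable => //.
- have := @lebesgue_measure_itv R `[a, b]; rewrite /= => ->.
  by case: ifPn => _; rewrite -?EFinB ltry.
- exact: bounded_cst.
Qed.

(** The mollifier is at most [C / e] on an interval of length [e], so the error
is bounded by a multiple of the mean oscillation of [f] on the ball of radius
[2 e] around [x], which tends to [0] at a Lebesgue point. *)
Lemma mollifier_cvg (f : R -> R) x : locally_integrable setT f -> lebesgue_pt f x ->
  \int[leb]_y (mollifier e x y * f y) @[e --> 0^'+] --> f x.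
Proof.
move=> lf px; have [C C0 hC] := mollifier_le.
have intf a b : leb.-integrable `[a, b] (EFin \o f).
  have [mf _ h] := lf; apply/integrableP; split.
    by apply/measurable_EFinP; exact: measurable_funS mf.
  by apply: h => //; exact: segment_compact.
apply/cvgrPdist_le => eps eps0.
have d0 : 0 < eps / (4 * C) by rewrite divr_gt0// mulr_gt0.
have hd : \forall r \near (0 : R)^'+, (davg f x r <= (eps / (4 * C))%:E)%E.
  move: px => /fine_cvgP[h1 /cvgrPdist_le/(_ _ d0) h2].
  near=> r; have hr : davg f x r \is a fin_num by near: r; exact: h1.
  rewrite -(fineK hr) lee_fin; apply: (le_trans (ler_norm _)).
  have : `|0 - fine (davg f x r)| <= eps / (4 * C) by near: r; exact: h2.
  by rewrite sub0r normrN.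
have {hd} [del /= del0 hd] : exists2 del : R, 0 < del & forall r, 0 < r -> r < del -> (davg f x r <= (eps / (4 * C))%:E)%E.
  move: hd => [del /= del0 hd]; exists del => // r r0 rd.
  by apply: hd => //=; rewrite sub0r normrN gtr0_norm.
near=> e.
have e0 : 0 < e by near: e; exact: nbhs_right_gt.
(* The open ball of radius [2 e] contains the closed interval [[x, x + e]]. *)
have ed : e * 2 < del.
  by rewrite -ltr_pdivlMr//; near: e; apply: nbhs_right_lt; rewrite divr_gt0.
have {}hd := hd (e * 2) (mulr_gt0 e0 (ltr0n _ 2)) ed.
have mK : measurable (`[x, x + e]%classic : set R) by exact: measurable_itv.
have kf : leb.-integrable `[x, x + e] (EFin \o (fun y => mollifier e x y * f y)).
  apply: (@integrable_bounded_mul _ _ _ leb _ (mollifier e x) f mK); [exact: mollifier_measurable|exact: mollifier_bounded|exact: intf].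
have kc : leb.-integrable `[x, x + e] (EFin \o (fun y => mollifier e x y * f x)).
  apply: (@integrable_bounded_mul _ _ _ leb _ (mollifier e x) (fun=> f x) mK); [exact: mollifier_measurable|exact: mollifier_bounded|].
  exact: integrable_cst_itv.
rewrite mollifier_supp// -[X in X - _]mul1r -(integral_mollifier x e0) -RintegralZr//; last first.
  rewrite (_ : mollifier e x = fun y => mollifier e x y * 1); last by apply/funext => y; rewrite mulr1.
  apply: (@integrable_bounded_mul _ _ _ leb _ (mollifier e x) (fun=> 1) mK); [exact: mollifier_measurable|exact: mollifier_bounded|].
  exact: integrable_cst_itv.
rewrite -RintegralB//.
have kb : leb.-integrable `[x, x + e] (EFin \o (fun y => mollifier e x y * f x - mollifier e x y * f y)).
  exact: integrable_subR.
apply: le_trans; first by apply: le_normr_Rintegral => //; exact: kb.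
have fb : leb.-integrable `[x - e * 2, x + e * 2] (EFin \o (fun y => `|f y - f x|)).
  apply: (@integrable_norm _ _ _ leb _ (fun y => f y - f x)).
  by apply: integrable_subR => //; exact: integrable_cst_itv.
have sub : `[x, x + e] `<=` (ball x (e * 2) : set R).
  move=> y /=; rewrite in_itv/= => /andP[h1 h2].
  rewrite /ball/= distrC ger0_norm ?subr_ge0//; lra.
have sub2 : ball x (e * 2) `<=` (`[x - e * 2, x + e * 2] : set R).
  move=> y /=; rewrite /ball/= in_itv/= ltr_distlC => /andP[h1 h2].
  by rewrite !ltW.
have mB : measurable (ball x (e * 2) : set R) by exact: measurable_ball.
have fb2 : leb.-integrable (ball x (e * 2)) (EFin \o (fun y => `|f y - f x|)).
  apply: (@integrableS _ _ _ leb `[x - e * 2, x + e * 2]) => //.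
have fb1 : leb.-integrable `[x, x + e] (EFin \o (fun y => `|f y - f x|)).
  by apply: (@integrableS _ _ _ leb (ball x (e * 2))).
have bound1 : \int[leb]_(t in `[x, x + e]) `|mollifier e x t * f x - mollifier e x t * f t|
    <= C / e * \int[leb]_(t in `[x, x + e]) `|f t - f x|.
  rewrite -RintegralZl//; apply: le_Rintegral => //.
  - exact: integrable_norm kb.
  - exact: integrable_scaleR.
  - move=> t _; rewrite -mulrBr normrM distrC ler_wpM2r// ger0_norm ?mollifier_ge0//.
    exact: hC.
apply: (le_trans bound1).
have bound2 : \int[leb]_(t in `[x, x + e]) `|f t - f x| <= \int[leb]_(t in ball x (e * 2)) `|f t - f x|.
  rewrite /Rintegral fine_le ?integrable_fin_num//.
  apply: ge0_subset_integral => //.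
  by case/integrableP : fb2.
have bound3 : \int[leb]_(t in ball x (e * 2)) `|f t - f x| <= e * 4 * (eps / (4 * C)).
  rewrite -lee_fin fineK ?integrable_fin_num//.
  move: hd; rewrite /davg /iavg lebesgue_measure_ball; last by rewrite ltW// mulr_gt0.
  rewrite inver mulrn_eq0/= gt_eqF ?mulr_gt0// muleC lee_pdivrMr ?mulrn_wgt0 ?mulr_gt0//.
  move/le_trans; apply; rewrite -EFinM lee_fin mulrC (_ : e * 2 *+ 2 = e * 4)//; ring.
have Ce0 : 0 <= C / e by rewrite divr_ge0 ?ltW.
apply: (le_trans (ler_wpM2l Ce0 (le_trans bound2 bound3))).
rewrite le_eqVlt; apply/orP; left; apply/eqP; field.
by rewrite !gt_eqF.
Unshelve. all: by end_near. Qed.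

End mollification.

Section ae_mollification.
Context {R : realType}.
Local Notation leb := (@lebesgue_measure R).

(** Lebesgue's theorem needs a function that is locally integrable on the whole
line, and [J] may fail to be so at [T]: it is truncated to intervals
[[- n, T - 1 / (n + 1)]] exhausting [(-oo, T)]. *)
Lemma ae_mollifier_cvg (J : R -> R) (T : R) :
  (forall a b, b < T -> leb.-integrable `[a, b] (EFin \o J)) ->
  {ae leb, forall s, s < T ->
    \int[leb]_y (mollifier e s y * J y) @[e --> 0^'+] --> J s}.
Proof.
move=> intJ.
pose A n : set R := [set` `[- n%:R, T - n.+1%:R^-1]].
have lf n : locally_integrable setT (J \_ (A n)).
  by apply: integrable_locally; [exact: measurable_itv|apply: intJ; rewrite ltrBlDr ltrDl invr_gt0].
have := @ae_foralln _ _ _ leb (fun n s => lebesgue_pt (J \_ (A n)) s) (fun n => lebesgue_differentiation (lf n)).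
apply: filterS => s hs sT.
have [n [n1 n2]] : exists n : nat, - n%:R < s /\ s < T - n.+1%:R^-1.
  near \oo => n; exists n; split.
    rewrite ltrNl; near: n; exact: nbhs_infty_gtr.
  rewrite ltrBrDr -ltrBrDl -[ltRHS]invrK ltf_pV2 ?posrE ?invr_gt0 ?subr_gt0//.
  rewrite -natr1 ltr_wpDr//; near: n; exact: nbhs_infty_gtr.
have As : (J \_ (A n)) s = J s.
  by rewrite patchE mem_set// /A /= in_itv/= !ltW.
rewrite -As; apply: cvg_trans (mollifier_cvg (lf n) (hs n)).
apply: near_eq_cvg; near=> e.
have e0 : 0 < e by near: e; exact: nbhs_right_gt.
rewrite !mollifier_supp//; apply: eq_Rintegral => y; rewrite inE/= in_itv/= => /andP[y1 y2].
congr (_ * _); rewrite patchE mem_set// /A/= in_itv/= (le_trans (ltW n1) y1)/=.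
apply: (le_trans y2); rewrite -lerBrDl; near: e; apply: nbhs_right_le.
by rewrite subr_gt0.
Unshelve. all: by end_near. Qed.

Lemma le_of_mollified (J : R -> R) s s' T : s < s' -> s' < T ->
  (forall e, 0 < e -> s' + e < T ->
     \int[leb]_y (mollifier e s' y * J y) <= \int[leb]_y (mollifier e s y * J y)) ->
  \int[leb]_y (mollifier e s y * J y) @[e --> 0^'+] --> J s ->
  \int[leb]_y (mollifier e s' y * J y) @[e --> 0^'+] --> J s' ->
  J s' <= J s.
Proof.
move=> ss' s'T h c c'; apply: (ler_cvg_to c' c); near=> e; apply: h.
  by near: e; exact: nbhs_right_gt.
by rewrite -ltrBrDl; near: e; apply: nbhs_right_lt; rewrite subr_gt0.
Unshelve. all: by end_near. Qed.

End ae_mollification.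

(** * Testing the adjoint equation with a subsolution *)

Section compact_bound.
Context {R : realType} {V : normedModType R}.

Lemma continuous_bounded_on_compact (f : V -> R) (K : set V) : compact K ->
  continuous f -> exists M, forall z, K z -> `|f z| <= M.
Proof.
move=> cK cf.
have : compact (f @` K) by apply: continuous_compact => //; exact: continuous_subspaceT.
move/compact_bounded => [M [_ hM]].
exists (M + 1) => z Kz; apply: (hM (M + 1)); first by rewrite ltrDl.
by exists z.
Qed.

(** Near a point of the open complement of [C] the function is constant. *)
Lemma derive_outside_closed (f : V -> R) (C : set V) v : closed C ->
  (forall z, ~ C z -> f z = 0) -> forall z, ~ C z -> 'D_v f z = 0.
Proof.
move=> cC f0 z nCz.
rewrite (@near_eq_derive _ _ _ _ (cst 0)); first exact: derive_cst.
have oC : open (~` C) by exact: closed_openC.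
near=> y; apply: f0; near: y.
exact: (open_nbhs_nbhs (conj oC nCz)).
Unshelve. all: by end_near. Qed.

End compact_bound.

Section adjoint.
Context {R : realType} {d : nat}.
Notation V := (R * 'rV[R]_d)%type.
Notation VM := (measurableTypeR R * 'rV[R]_d)%type.
Local Notation leb := (@lebesgue_measure R).
Local Notation tx := (@lebesgue_tx R d).
Local Notation rv := (@lebesgue_rV R d).

Definition slab (a b M : R) : set V := `[a, b] `*` @closed_box R d M.

Lemma slab_compact a b M : compact (slab a b M).
Proof. by apply: compact_setX; [exact: segment_compact|exact: compact_closed_box]. Qed.

Lemma slab_measurable a b M : measurable (slab a b M : set VM).
Proof. by apply: measurableX; [exact: measurable_itv|exact: measurable_closed_box]. Qed.

Variables (t : R) (v : V -> R).
Notation D := (`]-oo, t[ `*` [set: 'rV[R]_d]).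
Hypothesis locv : locally_integrable_tx D v.

Lemma measurable_past : measurable (D : set VM).
Proof. by apply: measurableX; [exact: measurable_itv|exact: measurableT]. Qed.

Lemma slab_past a b M : b < t -> slab a b M `<=` D.
Proof.
move=> bt z [/= + _]; rewrite in_itv/= => /andP[_ h].
by split => //=; rewrite in_itv/= (le_lt_trans h).
Qed.

(** The weights [q] stand for test functions, and for images of test functions
under the operator, whose coefficients are only measurable: what matters is a
bounded measurable function supported in a compact slab before time [t]. *)

Section weight.
Variables (a b M : R) (q : V -> R).
Hypotheses (bt : b < t) (mq : measurable_fun [set: VM] q).
Hypothesis bq : exists C, forall z, slab a b M z -> `|q z| <= C.
Hypothesis q0 : forall z, ~ slab a b M z -> q z = 0.

Lemma weight_integrableK : tx.-integrable (slab a b M) (EFin \o (fun z => q z * v z)).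
Proof.
apply: integrable_bounded_mul; first exact: slab_measurable.
- exact: measurable_funS mq.
- have [C hC] := bq; exists C; split; first by rewrite num_real.
  by move=> x Cx z Kz /=; apply: (le_trans (hC z Kz)); exact: ltW.
- have [_] := locv; apply; [exact: slab_compact|exact: slab_past].
Qed.

Let weight_restrict : (fun z => q z * v z) \_ (slab a b M) = (fun z => q z * v z).
Proof.
apply/funext => z; rewrite patchE; case: ifPn => // /negP; rewrite inE => h.
by rewrite q0// mul0r.
Qed.

Lemma weight_integrable : tx.-integrable setT (EFin \o (fun z => q z * v z)).
Proof.
have := weight_integrableK; rewrite integrable_mkcond; last exact: slab_measurable.
by rewrite restrict_EFin weight_restrict.
Qed.

Lemma weight_integrableD : tx.-integrable D (EFin \o (fun z => q z * v z)).
Proof.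
apply: (@integrableS _ _ _ tx setT) => //; first exact: measurable_past.
exact: weight_integrable.
Qed.

Lemma weight_RintegralD : \int[tx]_(z in D) (q z * v z) = \int[tx]_z (q z * v z).
Proof.
rewrite Rintegral_mkcond; apply: eq_Rintegral => z _; rewrite patchE; case: ifPn => // /negP.
rewrite inE => h; rewrite q0 ?mul0r//.
by move=> h'; apply: h; exact: slab_past h'.
Qed.

(** The slices are assumed to have a finite integral at every time, not just at
almost every time, which identifies [g] as a function and not as a class. *)
Lemma weight_Fubini (g : R -> R) :
  (forall s, \int[rv]_y ((q (s, y) * v (s, y))%:E) = (g s)%:E)%E ->
  leb.-integrable setT (EFin \o g) /\
  \int[leb]_s g s = \int[tx]_(z in D) (q z * v z).
Proof.
move=> hg; rewrite weight_RintegralD.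
have I := weight_integrable.
have gE : EFin \o g = fubini_F rv (EFin \o (fun z => q z * v z)).
  by apply/funext => s; rewrite /= -hg.
split; first by rewrite gE; exact: integrable_fubini_F.
rewrite /Rintegral; congr fine; rewrite -[RHS](integral12_prod_meas1 I).
by apply: eq_integral => s _; rewrite -[LHS]/((EFin \o g) s) gE.
Qed.

End weight.

Lemma weight_slice (a b M : R) (h : R -> R) (w : V -> R) :
  b < t -> measurable_fun setT h -> (exists C, forall s, `|h s| <= C) ->
  (forall s, ~ (a <= s <= b) -> h s = 0) ->
  elementary_tx w -> (forall z, ~ closed_box M z.2 -> w z = 0) ->
  (forall s, s < t -> rv.-integrable setT (fun y => (v (s, y) * w (s, y))%:E)) ->
  let J s := \int[rv]_y (v (s, y) * w (s, y)) in
  [/\ leb.-integrable setT (EFin \o (fun s => h s * J s)),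
      tx.-integrable D (EFin \o (fun z => (h z.1 * w z) * v z)) &
      \int[leb]_s (h s * J s) = \int[tx]_(z in D) ((h z.1 * w z) * v z)].
Proof.
move=> bt mh [C hC] h0 gw w0 intw J.
have mq : measurable_fun [set: VM] (fun z : VM => h z.1 * w z).
  apply: measurable_funM; last exact: elementary_tx_measurable.
  exact: (measurableT_comp mh measurable_fst).
have bq : exists C, forall z, slab a b M z -> `|h z.1 * w z| <= C.
  have [C' hC'] := continuous_bounded_on_compact (@slab_compact a b M) (elementary_tx_continuous gw).
  exists (C * C') => z Kz; rewrite normrM ler_pM//; exact: hC'.
have q0 z : ~ slab a b M z -> h z.1 * w z = 0.
  move=> nK; have [|hz] := pselect (a <= z.1 <= b); last by rewrite h0 ?mul0r.
  move=> z1; rewrite w0 ?mulr0// => z2; apply: nK; split => //=.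
have gE s : (\int[rv]_y ((h s * w (s, y) * v (s, y))%:E) = (h s * J s)%:E)%E.
  have [st|ts] := ltP s t.
    transitivity (\int[rv]_y ((h s)%:E * (v (s, y) * w (s, y))%:E))%E.
      by apply: eq_integral => y _; rewrite -EFinM -mulrA [w _ * _]mulrC.
    rewrite integralZl//; last exact: intw.
    rewrite EFinM /J /Rintegral fineK//; apply: integrable_fin_num => //.
    exact: intw.
  have hs : h s = 0.
    by apply: h0 => /andP[_ sb]; move: (le_lt_trans sb bt); rewrite ltNge ts.
  by rewrite hs mul0r; under eq_integral do rewrite mul0r mul0r; rewrite integral0.
have [I E] := weight_Fubini bt mq bq q0 gE.
by split => //; exact: weight_integrableD bt mq bq q0.
Qed.

(** This is the previous lemma for the indicator function of [[a, b]]. *)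
Lemma slice_integrable (a b M : R) (w : V -> R) :
  b < t -> elementary_tx w -> (forall z, ~ closed_box M z.2 -> w z = 0) ->
  (forall s, s < t -> rv.-integrable setT (fun y => (v (s, y) * w (s, y))%:E)) ->
  leb.-integrable `[a, b] (EFin \o (fun s => \int[rv]_y (v (s, y) * w (s, y)))).
Proof.
move=> bt gw w0 intw.
have mI : measurable (`[a, b]%classic : set R) by exact: measurable_itv.
have h0 (s : R) : ~ (a <= s <= b) -> \1_(`[a, b]%classic : set R) s = 0 :> R.
  by move=> h; rewrite indicE memNset//= in_itv.
have hC : exists C : R, forall s : R, `|\1_(`[a, b]%classic : set R) s : R| <= C.
  by exists 1 => s; rewrite indicE; case: (_ \in _); rewrite ?normr1 ?normr0.
have [I _ _] := weight_slice bt (measurable_indic mI) hC h0 gw w0 intw.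
have := @integrableS _ _ _ leb setT `[a, b]%classic _ measurableT mI (@subsetT _ _) I.
apply: eq_integrable => //= s sab; rewrite indicE sab mul1r//.
Qed.

End adjoint.

Section ellipticity.
Context {R : realType} {d : nat}.
Implicit Types (A : 'M[R]_d) (x y : 'rV[R]_d).

Definition qform A x := \sum_i \sum_j A i j * x ord0 i * x ord0 j.

Lemma qform_delta A i : qform A (delta_mx ord0 i) = A i i.
Proof.
rewrite /qform (bigD1 i)//= [X in _ + X]big1 ?addr0; last first.
  by move=> k ki; apply: big1 => j _; rewrite !mxE/= (negbTE ki) mulr0 mul0r.
rewrite (bigD1 i)//= [X in _ + X]big1 ?addr0; last first.
  by move=> k ki; rewrite !mxE/= (negbTE ki) mulr0.
by rewrite !mxE !eqxx/= !mulr1.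
Qed.

Lemma qform_delta2 A i j : i != j ->
  qform A (delta_mx ord0 i + delta_mx ord0 j) = A i i + A i j + A j i + A j j.
Proof.
move=> ij; have ji : j != i by rewrite eq_sym.
have row k : \sum_l A k l * (delta_mx ord0 i + delta_mx ord0 j : 'rV_d) ord0 k *
    (delta_mx ord0 i + delta_mx ord0 j : 'rV_d) ord0 l =
    ((k == i)%:R + (k == j)%:R) * (A k i + A k j).
  rewrite (bigD1 i)//= (bigD1 j)//= [X in _ + (_ + X)]big1 ?addr0; last first.
    move=> l /andP[li lj]; rewrite !mxE/= (negbTE li) (negbTE lj).
    by rewrite addr0 mulr0.
  by rewrite !mxE/= !eqxx (negbTE ij) (negbTE ji) /=; ring.
rewrite /qform; under eq_bigr do rewrite row.
rewrite (bigD1 i)//= (bigD1 j)//= [X in _ + (_ + X)]big1 ?addr0; last first.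
  by move=> l /andP[li lj]; rewrite (negbTE li) (negbTE lj) addr0 mul0r.
by rewrite !eqxx (negbTE ij) (negbTE ji) /=; ring.
Qed.

Lemma enorm_delta i : enorm (delta_mx ord0 i : 'rV[R]_d) ^+ 2 = 1.
Proof.
rewrite sqr_enorm (bigD1 i)//= big1 ?addr0; first by rewrite mxE !eqxx expr1n.
by move=> k ki; rewrite mxE /= (negbTE ki) expr0n.
Qed.

Lemma enorm_delta2 i j : i != j ->
  enorm (delta_mx ord0 i + delta_mx ord0 j : 'rV[R]_d) ^+ 2 = 2.
Proof.
move=> ij; have ji : j != i by rewrite eq_sym.
rewrite sqr_enorm (bigD1 i)//= (bigD1 j)//= big1 ?addr0; last first.
  by move=> l /andP[li lj]; rewrite !mxE/= (negbTE li) (negbTE lj) addr0 expr0n.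
by rewrite !mxE !eqxx /= (negbTE ij) (negbTE ji) addr0 add0r expr1n.
Qed.

(** Polarization: [2 a_ij] is the value of the form at [e_i + e_j] minus the
two diagonal entries. *)
Lemma elliptic_entry_le lam Lam a t x i j : 0 < lam -> elliptic lam Lam a ->
  `|a t x i j : R| <= Lam.
Proof.
move=> lam0 [_ sym ell].
have hd k : 0 <= a t x k k <= Lam.
  have := ell t x (delta_mx ord0 k); rewrite -/(qform _ _) qform_delta enorm_delta !mulr1.
  by move=> /andP[h ->]; rewrite (le_trans (ltW lam0) h).
have [->|ij] := eqVneq i j.
  by have /andP[h1 h2] := hd j; rewrite ger0_norm.
have := ell t x (delta_mx ord0 i + delta_mx ord0 j).
rewrite -/(qform _ _) qform_delta2// enorm_delta2//.
have aji : a t x j i = a t x i j by rewrite -[in LHS](sym t x) mxE.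
rewrite aji => /andP[h1 h2]; have /andP[h3 h4] := hd i; have /andP[h5 h6] := hd j.
rewrite ler_norml; apply/andP; split; lra.
Qed.

Lemma elliptic_trace_le lam Lam a t x : 0 < lam -> elliptic lam Lam a ->
  \sum_i a t x i i <= d%:R * Lam :> R.
Proof.
move=> lam0 ell; apply: (@le_trans _ _ (\sum_(i < d) Lam)).
  apply: ler_sum => i _; apply: le_trans (ler_norm _) _.
  exact: elliptic_entry_le ell.
by rewrite sumr_const card_ord mulr_natl.
Qed.

End ellipticity.

Section monotone.
Context {R : realType} {d : nat}.
Notation V := (R * 'rV[R]_d)%type.
Notation VM := (measurableTypeR R * 'rV[R]_d)%type.
Local Notation leb := (@lebesgue_measure R).
Local Notation tx := (@lebesgue_tx R d).
Local Notation rv := (@lebesgue_rV R d).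
Notation dt := (@dir_t R d).
Notation dx := (@dir_x R d).

Definition parabolic (a : R -> 'rV[R]_d -> 'M[R]_d) (w : V -> R) (z : V) : R :=
  'D_dt w z - \sum_i \sum_j a z.1 z.2 i j * 'D_(dx i) ('D_(dx j) w) z.

Definition subsolution a (w : V -> R) := forall z, parabolic a w z <= 0.

Lemma differentiable_time (eta : R -> R) (deta : R -> R) (z : V) :
  (forall s, is_derive s (1:R) eta (deta s)) ->
  differentiable (fun z : V => eta z.1) z /\
  forall v, 'D_v (fun z : V => eta z.1) z = deta z.1 * v.1.
Proof.
move=> deta'.
have [h1 h2] := differentiable_comp1 (deta' z.1) (tx_coord_differentiable None z).
split => // v; rewrite h2; congr (_ * _).
by have [_ /= ->] := is_derive_tx_coord None z v.
Qed.

(** The second derivatives are in space only, so the time factor goes through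
them and appears only in the product rule for the time derivative. *)
Lemma parabolic_time_mul a (eta deta : R -> R) (w : V -> R) (z : V) :
  (forall s, is_derive s (1:R) eta (deta s)) -> elementary_tx w ->
  parabolic a (fun z => eta z.1 * w z) z = deta z.1 * w z + eta z.1 * parabolic a w z.
Proof.
move=> de gw.
have Dx (f : V -> R) i : elementary_tx f ->
    'D_(dx i) (fun z => eta z.1 * f z) = fun z => eta z.1 * 'D_(dx i) f z.
  move=> gf; apply/funext => y; have [h1 h2] := differentiable_time y de.
  by rewrite derive_mul//; [rewrite h2 /= mulr0 mulr0 addr0|exact: elementary_tx_differentiable].
rewrite /parabolic; have [h1 h2] := differentiable_time z de.
rewrite derive_mul//; last exact: elementary_tx_differentiable.
rewrite h2 /= mulr1 (_ : \sum_i _ = eta z.1 * \sum_i \sum_j a z.1 z.2 i j * 'D_(dx i) ('D_(dx j) w) z).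
  by ring.
rewrite mulr_sumr; apply: eq_bigr => i _; rewrite mulr_sumr; apply: eq_bigr => j _.
have gj := elementary_tx_derive (dx j) gw.
by rewrite (Dx w j)// (congr1 (@^~ z) (Dx _ i gj)) mulrCA.
Qed.

Lemma parabolic_measurable lam Lam a w : elliptic lam Lam a -> elementary_tx w ->
  measurable_fun [set: VM] (parabolic a w).
Proof.
move=> [ma _ _] gw; apply: measurable_funB; first exact: (elementary_tx_measurable (elementary_tx_derive dt gw)).
apply: measurable_sum => i; apply: measurable_sum => j.
apply: measurable_funM; first exact: ma.
exact: (elementary_tx_measurable (elementary_tx_derive (dx i) (elementary_tx_derive (dx j) gw))).
Qed.

Lemma parabolic_bounded lam Lam a w (K : set V) : 0 < lam -> elliptic lam Lam a -> elementary_tx w ->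
  compact K -> exists C, forall z, K z -> `|parabolic a w z| <= C.
Proof.
move=> lam0 ell gw cK.
have [C0 h0] := continuous_bounded_on_compact cK (elementary_tx_continuous (elementary_tx_derive dt gw)).
have [C hC] : exists C : 'I_d -> 'I_d -> R, forall i j z, K z -> `|'D_(dx i) ('D_(dx j) w) z| <= C i j.
  have h i j := continuous_bounded_on_compact cK (elementary_tx_continuous (elementary_tx_derive (dx i) (elementary_tx_derive (dx j) gw))).
  exists (fun i j => sval (cid (h i j))) => i j z Kz.
  by case: (cid (h i j)) => /= c; exact.
exists (C0 + \sum_i \sum_j Lam * C i j) => z Kz.
apply: (le_trans (ler_normB _ _)); apply: lerD; first exact: h0.
apply: (le_trans (ler_norm_sum _ _ _)); apply: ler_sum => i _.
apply: (le_trans (ler_norm_sum _ _ _)); apply: ler_sum => j _.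
by rewrite normrM ler_pM//; [exact: elliptic_entry_le ell|exact: hC].
Qed.

Lemma parabolic_out a w M z : (forall z, ~ closed_box M z.2 -> w z = 0) ->
  ~ closed_box M z.2 -> parabolic a w z = 0.
Proof.
move=> w0 nz.
pose C : set V := snd @^-1` @closed_box R d M.
have cC : closed C.
  apply: (@closed_comp _ _ snd); first by move=> y _; exact: cvg_snd.
  by apply: compact_closed; [exact: norm_hausdorff|exact: compact_closed_box].
have w0' (y : V) : ~ C y -> w y = 0 by exact: w0.
have nz' : ~ C z by [].
rewrite /parabolic (derive_outside_closed dt cC w0' nz') big1 ?subrr// => i _.
rewrite big1// => j _.
by rewrite (derive_outside_closed (dx i) cC (derive_outside_closed (dx j) cC w0') nz') mulr0.
Qed.

(** Take [phi = eta(s) w] in the adjoint equation, with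
[eta] a smooth bump rising near [s] and falling near [s'].  Then
[P phi = eta' w + eta P w], and [eta P w <= 0] has a nonpositive integral against
[v >= 0]; hence [eta' w] has a nonnegative one.  As [eta'] is the difference of
the mollifiers at [s] and [s'], this is the stated inequality. *)
Lemma adjoint_monotone lam Lam a (t : R) (v : V -> R) (w : V -> R) (M s s' e : R) :
  0 < lam -> elliptic lam Lam a ->
  adjoint_solution a (`]-oo, t[ `*` setT) v ->
  (forall z, 0 <= v z) -> elementary_tx w -> (forall z, ~ closed_box M z.2 -> w z = 0) ->
  subsolution a w ->
  (forall s, s < t -> rv.-integrable setT (fun y => (v (s, y) * w (s, y))%:E)) ->
  let J s := \int[rv]_y (v (s, y) * w (s, y)) in
  0 < e -> s < s' -> s' + e < t ->
  \int[leb]_y (mollifier e s' y * J y) <= \int[leb]_y (mollifier e s y * J y).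
Proof.
move=> lam0 ell [lv adj] v0 gw w0 sub intw J e0 ss' s't.
pose D : set V := `]-oo, t[ `*` setT.
have mD : measurable (D : set VM) by exact: measurable_past.
pose eta (x : R) := step ((x - s) / e) - step ((x - s') / e).
have de (x : R) : is_derive x (1:R) eta (mollifier e s x - mollifier e s' x).
  exact: is_deriveB (is_derive_step_affine e s x) (is_derive_step_affine e s' x).
pose phi (z : V) := eta z.1 * w z.
have eta0 x : 0 <= eta x.
  rewrite subr_ge0 step_nondecreasing// ler_pM2r ?invr_gt0// lerD2l lerN2.
  exact: ltW.
have eta_out x : ~ (s <= x <= s' + e) -> eta x = 0.
  move=> /negP; rewrite negb_and -!ltNge /eta => /orP[h|h].
    rewrite !step_le0 ?subrr// pmulr_lle0 ?invr_gt0// subr_le0 ltW//.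
    exact: lt_trans h ss'.
  rewrite !step_ge1 ?subrr// ler_pdivlMr// mul1r lerBrDl ltW//.
  by apply: lt_trans h; rewrite ltrD2r.
have gaff (u : R) : elementary_tx (fun z : V => step ((z.1 - u) / e)).
  apply: (@elementary_comp _ _ _ _ step _ step_smooth1).
  apply: elementary_mul; last exact: elementary_cst.
  apply: elementary_add; last exact: elementary_cst.
  exact: (@elementary_coord _ _ _ (@tx_coord R d) None).
have geta : elementary_tx (fun z : V => eta z.1).
  exact: (elementary_add (gaff s) (elementary_opp (gaff s'))).
have gphi : elementary_tx phi by exact: elementary_mul.
have tphi : test_function D phi.
  split; first exact: elementary_tx_smooth.
  exists (slab s (s' + e) M); split; [exact: slab_compact|exact: slab_past|].
  move=> z nz; rewrite /phi; have [hz|/eta_out->] := pselect (s <= z.1 <= s' + e).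
    by rewrite w0 ?mulr0// => h; apply: nz; split => //=; rewrite in_itv.
  by rewrite mul0r.
have kb (u x : R) : s <= u -> u <= s' -> ~ (s <= x <= s' + e) -> mollifier e u x = 0.
  move=> su us h; apply: mollifier_out => // /andP[h1 h2]; apply: h.
  rewrite (le_trans su (ltW h1)) (le_trans (ltW h2))//=.
  by rewrite lerD2r.
have kC (u : R) : exists C : R, forall x, `|mollifier e u x| <= C.
  have [C C0 hC] := @mollifier_le R; exists (C / e) => x.
  by rewrite ger0_norm ?mollifier_ge0// hC.
have [I1 I1D E1] := weight_slice lv s't (@mollifier_measurable R e s setT) (kC s)
  (fun x => kb s x (lexx _) (ltW ss')) gw w0 intw.
have [I2 I2D E2] := weight_slice lv s't (@mollifier_measurable R e s' setT) (kC s')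
  (fun x => kb s' x (ltW ss') (lexx _)) gw w0 intw.
have meta : measurable_fun [set: VM] (fun z : VM => eta z.1).
  exact: elementary_tx_measurable.
have mq : measurable_fun [set: VM] (fun z : VM => eta z.1 * parabolic a w z).
  by apply: measurable_funM => //; exact: parabolic_measurable ell gw.
have bq : exists C, forall z, slab s (s' + e) M z -> `|eta z.1 * parabolic a w z| <= C.
  have [C hC] := parabolic_bounded lam0 ell gw (@slab_compact R d s (s' + e) M).
  exists (1 * C) => z Kz; rewrite normrM ler_pM//; last exact: hC.
  rewrite ger0_norm// /eta lerBlDr (le_trans (step_le1 _))// lerDl.
  exact: step_ge0.
have q0 z : ~ slab s (s' + e) M z -> eta z.1 * parabolic a w z = 0.
  move=> nz; have [hz|/eta_out->] := pselect (s <= z.1 <= s' + e); last by rewrite mul0r.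
  rewrite (@parabolic_out _ _ M) ?mulr0// => h; apply: nz.
  by split => //=; rewrite in_itv.
have I3D := weight_integrableD lv s't mq bq q0.
rewrite -/J in E1 E2 *; rewrite E1 E2 -subr_ge0 -RintegralB//; set X := (X in 0 <= X).
have := adj _ tphi; rewrite -/D.
rewrite (_ : \int[tx]_(z in D) _ =
  \int[tx]_(z in D) ((mollifier e s z.1 * w z * v z - mollifier e s' z.1 * w z * v z)
     + eta z.1 * parabolic a w z * v z)); last first.
  apply: eq_Rintegral => z _; rewrite -[X in _ * X]/(parabolic a phi z).
  rewrite /phi (parabolic_time_mul a z de gw); ring.
have I12 := @integrable_subR _ _ _ tx D (fun z => mollifier e s z.1 * w z * v z)
  (fun z => mollifier e s' z.1 * w z * v z) mD I1D I2D.
(* [X] is the integral of [v eta' w], and is opposite to that of [v eta P w]. *)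
rewrite RintegralD//.
rewrite -/X => /eqP; rewrite addr_eq0 => /eqP ->; rewrite oppr_ge0.
rewrite -oppr_ge0 -mulN1r -RintegralZl//.
apply: Rintegral_ge0 => z _; rewrite mulN1r oppr_ge0.
by rewrite mulr_le0_ge0// mulr_ge0_le0.
Qed.

End monotone.

(** * Comparison with a subsolution *)

Section density.
Context {R : realType}.

Lemma ae_forall_count d (T : measurableType d) (mu : {measure set T -> \bar R})
    (I : countType) (P : I -> T -> Prop) :
  (forall i, {ae mu, forall x, P i x}) -> {ae mu, forall x, forall i, P i x}.
Proof.
move=> h; pose Q n x := if unpickle n is Some i then P i x else True.
have : {ae mu, forall x, forall n, Q n x}.
  by apply: ae_foralln => n; rewrite /Q; case: unpickle => [i|]; [exact: h|exact: aeW].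
by apply: filterS => x hx i; have := hx (pickle i); rewrite /Q pickleK.
Qed.

Lemma ae_itvoo (P : R -> Prop) (a b : R) : a < b ->
  {ae (@lebesgue_measure R), forall x, P x} -> exists x, a < x < b /\ P x.
Proof.
move=> ab [N [mN N0 sub]]; apply: contrapT => h.
have : (lebesgue_measure (`]a, b[%classic : set R) <= lebesgue_measure N)%E.
  apply: le_measure; rewrite ?inE//.
  move=> x /=; rewrite in_itv/= => xab; apply: sub => /= Px; apply: h.
  by exists x.
rewrite N0 lebesgue_measure_itv/= lte_fin ab -EFinB lee_fin leNgt subr_gt0.
by rewrite ab.
Qed.

(** The initial condition at time [s] concerns the points at times after [s];
hence rational times strictly to the right. *)
Lemma rat_right_nbhs (s : R) (A : set R) : nbhs s A ->
  exists q : rat, s < ratr q /\ A (ratr q).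
Proof.
move=> /nbhs_ballP[e /= e0 hA].
have := @rat_in_itvoo R s (s + e); rewrite ltrDl => /(_ e0)[q].
rewrite in_itv/= => /andP[h1 h2]; exists q; split=> //; apply: hA.
by rewrite /ball/= distrC gtr0_norm ?subr_gt0// ltrBlDl.
Qed.

Definition ratr_rV d (q : 'rV[rat]_d) : 'rV[R]_d := map_mx ratr q.

Lemma rat_rV_nbhs d (x : 'rV[R]_d) (B : set 'rV[R]_d) : nbhs x B ->
  exists q : 'rV[rat]_d, B (ratr_rV q).
Proof.
move=> /nbhs_ballP[e /= e0 hB].
have h i : exists q : rat, x ord0 i < ratr q < x ord0 i + e.
  have := @rat_in_itvoo R (x ord0 i) (x ord0 i + e).
  by rewrite ltrDl => /(_ e0)[q]; rewrite in_itv/=; exists q.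
exists (\row_i sval (cid (h i))); apply: hB.
split=> // i j; rewrite ord1 /ratr_rV !mxE; case: (cid _) => q /= /andP[h1 h2].
rewrite /ball/= distrC gtr0_norm ?subr_gt0//; rewrite ltrBlDl//.
Qed.

End density.

Lemma continuous_pair_l {U W : topologicalType} (s : U) :
  continuous (fun y : W => (s, y)).
Proof. by move=> y; apply: cvg_pair => /=; [exact: cvg_cst|exact: cvg_id]. Qed.

Lemma continuous_pair_r {U W : topologicalType} (y : W) :
  continuous (fun s : U => (s, y)).
Proof. by move=> s; apply: cvg_pair => /=; [exact: cvg_id|exact: cvg_cst]. Qed.

Section comparison.
Context {R : realType} {d : nat}.
Notation V := (R * 'rV[R]_d)%type.
Notation VM := (measurableTypeR R * 'rV[R]_d)%type.
Local Notation leb := (@lebesgue_measure R).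
Local Notation rv := (@lebesgue_rV R d).

Variables (lam Lam : R) (a : R -> 'rV[R]_d -> 'M[R]_d).
Variable Gamma : R -> 'rV[R]_d -> R -> 'rV[R]_d -> R.
Hypotheses (lam0 : 0 < lam) (ell : elliptic lam Lam a).
Hypothesis fund : fundamental_solution a Gamma.
Variables (w : V -> R) (M : R).
Hypotheses (gw : elementary_tx w) (w0 : forall z, ~ closed_box M z.2 -> w z = 0).
Hypothesis sub : subsolution a w.

Definition evolve (s : R) (z : V) : R := \int[rv]_y (Gamma z.1 z.2 s y * w (s, y)).

Lemma slice_measurable s : measurable_fun [set: 'rV[R]_d] (fun y => w (s, y)).
Proof.
have := measurableT_comp (elementary_tx_measurable gw) (@pair1_measurable _ _ (measurableTypeR R) 'rV[R]_d s).
exact.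
Qed.

Lemma slice_bounded s : exists C : R, forall y, `|w (s, y)| <= C.
Proof.
have [C hC] := continuous_bounded_on_compact (@slab_compact R d s s M) (elementary_tx_continuous gw).
exists (Num.max C 0) => y; have [h|h] := pselect (closed_box M y); last first.
  by rewrite w0// normr0 le_max lexx orbT.
rewrite le_max hC//; split => //=; first by rewrite in_itv/= lexx.
Qed.

Lemma slice_continuous s : continuous (fun y : 'rV[R]_d => w (s, y)).
Proof.
move=> y; apply: (@continuous_comp _ _ _ (fun y : 'rV[R]_d => (s, y)) w); last exact: elementary_tx_continuous.
exact: continuous_pair_l.
Qed.

Lemma evolve_integrable s t x : s < t ->
  rv.-integrable setT (fun y => (Gamma t x s y * w (s, y))%:E).
Proof.
move=> st; have [h _ _ _] := fundamental_cauchy fund s (slice_measurable s) (slice_bounded s).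
exact: h.
Qed.

Lemma evolve_continuous s (z : V) : s < z.1 -> {for z, continuous (evolve s)}.
Proof.
move=> sz; have [_ [h _] _ _] := fundamental_cauchy fund s (slice_measurable s) (slice_bounded s).
by apply: h; split => //=; rewrite in_itv/= sz.
Qed.

Lemma evolve_initial s x :
  evolve s @ within (`]s, +oo[ `*` setT) (nbhs (s, x)) --> w (s, x).
Proof.
have [_ _ _ h] := fundamental_cauchy fund s (slice_measurable s) (slice_bounded s).
by apply: h; exact: slice_continuous.
Qed.

Let pt (p : rat * 'rV[rat]_d) : V := (ratr p.1, ratr_rV p.2).

(** A time is good if it is a Lebesgue point, in this weak sense, for every
rational point [(t, x)].  The null set of bad times has to be the same for all
[(t, x)], because [(t, x)] varies in the limit that follows. *)

Let good (s : R) := forall p, s < (pt p).1 ->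
  \int[leb]_y (mollifier e s y * evolve y (pt p)) @[e --> 0^'+] --> evolve s (pt p).

Let good_ae : {ae leb, forall s, good s}.
Proof.
apply: ae_forall_count => p; apply: ae_mollifier_cvg => b c cp.
have [lv _] := fundamental_adjoint fund (pt p).1 (pt p).2.
exact: (@slice_integrable _ _ _ (fun z => Gamma (pt p).1 (pt p).2 z.1 z.2) lv b c M w cp gw w0 (fun s sp => evolve_integrable _ sp)).
Qed.

Let good_le s s' p : good s -> good s' -> s < s' -> s' < (pt p).1 ->
  evolve s' (pt p) <= evolve s (pt p).
Proof.
move=> gs gs' ss' s'p.
apply: (@le_of_mollified _ (fun y => evolve y (pt p)) s s' (pt p).1 ss' s'p).
- move=> e e0 se.
  apply: (@adjoint_monotone _ _ lam Lam a (pt p).1 (fun z => Gamma (pt p).1 (pt p).2 z.1 z.2) w M) => //.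
  + exact: (fundamental_adjoint fund).
  + by move=> z; exact: (fundamental_ge0 fund).
  + by move=> u up; exact: evolve_integrable.
- by apply: gs; exact: lt_trans s'p.
- exact: gs'.
Qed.

(** If the inequality failed, then [evolve s] would be below, and [evolve s'] above,
some number [m] at all points close to [(s', x)] and later than [s'],
including a rational one, against [good_le]. *)

Let good_initial s s' x : good s -> good s' -> s < s' -> w (s', x) <= evolve s (s', x).
Proof.
move=> gs gs' ss'; rewrite leNgt; apply/negP => h.
pose m := (evolve s (s', x) + w (s', x)) / 2.
have m1 : evolve s (s', x) < m by rewrite /m; lra.
have m2 : m < w (s', x) by rewrite /m; lra.
have c1 : \forall z \near nbhs ((s', x) : V), evolve s z < m.
  exact: (@evolve_continuous s (s', x) ss' _ (lt_nbhsl m1)).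
have c2 : \forall z \near nbhs ((s', x) : V), (`]s', +oo[ `*` setT) z -> m < evolve s' z.
  by have := @evolve_initial s' x _ (lt_nbhsr m2).
have [[A B] /= [nA nB] AB] : nbhs ((s', x) : V) (fun z => evolve s z < m /\ ((`]s', +oo[ `*` setT) z -> m < evolve s' z)).
  by apply: filterI.
have [q [s'q Aq]] := rat_right_nbhs nA.
have [r Br] := rat_rV_nbhs nB.
have [|h1 h2] := AB (pt (q, r)); first by split.
have := good_le gs gs' ss' (_ : s' < (pt (q, r)).1); rewrite leNgt => /(_ s'q)/negP; apply.
apply: (lt_trans h1); apply: h2; split => //=; by rewrite in_itv/= s'q.
Qed.

(** The good times are dense, and both sides are continuous in [t > s]. *)
Lemma comparison : {ae leb, forall s, forall t x, s < t -> w (t, x) <= evolve s (t, x)}.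
Proof.
have := good_ae; apply: (@filterS _ _ (ae_filter_ringOfSetsType leb)) => s gs t x st; rewrite leNgt; apply/negP => h.
have c : {for t, continuous (fun t' => w (t', x) - evolve s (t', x))}.
  apply: cvgB.
    apply: (@continuous_comp _ _ _ (fun t' : R => (t', x)) w); last exact: elementary_tx_continuous.
    exact: continuous_pair_r.
  apply: (@continuous_comp _ _ _ (fun t' : R => (t', x)) (evolve s)).
    exact: continuous_pair_r.
  exact: evolve_continuous.
have : \forall t' \near t, 0 < w (t', x) - evolve s (t', x).
  by apply: (c _ (lt_nbhsr _)); rewrite subr_gt0.
move=> /nbhs_ballP[e /= e0 he].
have := ae_itvoo (_ : t < t + e) good_ae; rewrite ltrDl => /(_ e0)[s' [/andP[s1 s2] gs']].
have := good_initial x gs gs' (lt_trans st s1); rewrite leNgt => /negP; apply.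
rewrite -subr_gt0; apply: he.
by rewrite /ball/= distrC gtr0_norm ?subr_gt0// ltrBlDl.
Qed.

End comparison.

(** * A subsolution travelling from y to x *)

Section barrier_ineq.
Context {R : realType}.

(** The algebra behind [barrier_subsolution], in terms of [p = 1 / depth].  The
good term is [- 4 p^4 A], where [A >= lam (1 - p^-1)].  One quarter of it absorbs
the transport term [2 p^2 S], another quarter the term [8 p^3 A] by
[p^2 A (p - 4)^2 >= 0], and the half that is left beats all multiples of
[p^2]. *)
Lemma barrier_ineq (lam Lam p A tr S Y K n : R) :
  0 < lam -> lam <= Lam -> 1 <= p -> lam * (1 - p^-1) <= A -> A <= Lam ->
  tr <= n * Lam -> K = 2 * n * Lam + 16 * Lam + lam ->
  2 * p ^+ 2 * S <= p ^+ 4 * A + Y ->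
  2 * p ^+ 2 * S + 2 * p ^+ 2 * tr - 4 * (p ^+ 4 - 2 * p ^+ 3) * A
    <= Y + K ^+ 2 / (4 * lam).
Proof.
move=> lam0 lL p1 hA AL htr KE hS.
have p0 : 0 < p by lra.
have h1 : p ^+ 4 * A >= lam * (p ^+ 4 - p ^+ 3).
  have -> : lam * (p ^+ 4 - p ^+ 3) = p ^+ 4 * (lam * (1 - p^-1)).
    by field; rewrite gt_eqF.
  by rewrite ler_wpM2l// exprn_ge0// ltW.
have A0 : 0 <= A.
  by apply: le_trans hA; rewrite mulr_ge0 ?(ltW lam0)// subr_ge0 invf_le1.
have h2 : 0 <= p ^+ 2 * A * (p - 4) ^+ 2 by rewrite mulr_ge0 ?sqr_ge0// mulr_ge0 ?sqr_ge0.
have h3 : p ^+ 2 * A <= p ^+ 2 * Lam by rewrite ler_wpM2l// sqr_ge0.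
have h4 : p ^+ 2 * tr <= p ^+ 2 * (n * Lam) by rewrite ler_wpM2l// sqr_ge0.
have h5 : 0 <= lam * (p ^+ 2 * (p - 1) ^+ 2) by rewrite mulr_ge0 ?(ltW lam0)// mulr_ge0 ?sqr_ge0.
have h6 : K * p ^+ 2 - lam * p ^+ 4 <= K ^+ 2 / (4 * lam).
  rewrite ler_pdivlMr ?mulr_gt0// -subr_ge0.
  have -> : K ^+ 2 - (K * p ^+ 2 - lam * p ^+ 4) * (4 * lam) = (K - 2 * lam * p ^+ 2) ^+ 2 by ring.
  exact: sqr_ge0.
have e2 : p ^+ 2 * A * (p - 4) ^+ 2 = p ^+ 4 * A - 8 * (p ^+ 3 * A) + 16 * (p ^+ 2 * A) by ring.
have e5 : lam * (p ^+ 2 * (p - 1) ^+ 2) = lam * p ^+ 4 - 2 * (lam * p ^+ 3) + lam * p ^+ 2 by ring.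
have e6 : K * p ^+ 2 = 2 * (p ^+ 2 * (n * Lam)) + 16 * (p ^+ 2 * Lam) + lam * p ^+ 2.
  by rewrite KE; ring.
rewrite e2 in h2; rewrite e5 in h5; rewrite e6 in h6.
have e1 : lam * (p ^+ 4 - p ^+ 3) = lam * p ^+ 4 - lam * p ^+ 3 by ring.
rewrite e1 in h1.
have e7 : 4 * (p ^+ 4 - 2 * p ^+ 3) * A = 4 * (p ^+ 4 * A) - 8 * (p ^+ 3 * A) by ring.
have e8 : 2 * p ^+ 2 * tr = 2 * (p ^+ 2 * tr) by ring.
rewrite e7 e8.
lra.
Qed.

End barrier_ineq.

(** The parameters: [b] is the rate of damping, [r] the radius of the support,
[s0] the time at which the damping factor is [1], [s1] the time at which the
centre leaves [y], and [1 / k] the duration of its journey to [x]. *)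

Section barrier.
Context {R : realType} {d : nat}.
Notation V := (R * 'rV[R]_d)%type.
Notation dt := (@dir_t R d).
Notation dx := (@dir_x R d).

Variables (b r s0 s1 k : R) (x y : 'rV[R]_d).

Definition center_path (s : R) : 'rV[R]_d := y + step ((s - s1) * k) *: (x - y).
Definition offset (i : 'I_d) (z : V) : R := z.2 ord0 i - center_path z.1 ord0 i.
(** Positive exactly inside the moving ball, and [1] at its centre. *)
Definition depth (z : V) : R := 1 - r ^- 2 * \sum_i offset i z * offset i z.
Definition barrier (z : V) : R := expR (- b * (z.1 - s0)) * cutoff (depth z).

Let gtime : elementary_tx (fun z : V => z.1).
Proof. exact: (@elementary_coord _ _ _ (@tx_coord R d) None). Qed.

Let gspace i : elementary_tx (fun z : V => z.2 ord0 i).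
Proof. exact: (@elementary_coord _ _ _ (@tx_coord R d) (Some i)). Qed.

Let offsetE i : offset i = fun z => z.2 ord0 i + - (y ord0 i + step ((z.1 + - s1) * k) * (x - y) ord0 i).
Proof. by apply/funext => z; rewrite /offset /center_path !mxE. Qed.

Let gstep : elementary_tx (fun z : V => step ((z.1 + - s1) * k)).
Proof.
apply: (@elementary_comp _ _ _ _ step _ step_smooth1).
apply: elementary_mul; last exact: elementary_cst.
by apply: elementary_add => //; exact: elementary_cst.
Qed.

Lemma elementary_offset i : elementary_tx (offset i).
Proof.
rewrite offsetE; apply: elementary_add; first exact: gspace.
apply: (@elementary_opp _ _ _ _ (fun z : V => y ord0 i + step ((z.1 + - s1) * k) * (x - y) ord0 i)).
apply: elementary_add; first exact: elementary_cst.
by apply: elementary_mul => //; exact: elementary_cst.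
Qed.

Lemma elementary_depth : elementary_tx depth.
Proof.
apply: elementary_add; first exact: elementary_cst.
apply: (@elementary_opp _ _ _ _ (fun z : V => r ^- 2 * \sum_i offset i z * offset i z)).
apply: elementary_mul; first exact: elementary_cst.
apply: (@elementary_sum _ _ _ _ d (fun i z => offset i z * offset i z)) => i.
by apply: elementary_mul; exact: elementary_offset.
Qed.

Let gexp : elementary_tx (fun z : V => expR (- b * (z.1 - s0))).
Proof.
apply: (@elementary_comp _ _ _ _ expR _ expR_smooth1).
apply: elementary_mul; first exact: elementary_cst.
by apply: elementary_add => //; exact: elementary_cst.
Qed.

Let gcutoff : elementary_tx (fun z => cutoff (depth z)).
Proof. by apply: (@elementary_comp _ _ _ _ cutoff); [exact: flat_smooth1|exact: elementary_depth]. Qed.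

Let gcutoff1 : elementary_tx (fun z => cutoff1 (depth z)).
Proof. by apply: (@elementary_comp _ _ _ _ cutoff1); [exact: flat_smooth1|exact: elementary_depth]. Qed.

Lemma elementary_barrier : elementary_tx barrier.
Proof. exact: elementary_mul. Qed.

Definition velocity (s : R) (i : 'I_d) : R := step1 ((s - s1) * k) * k * (x ord0 i - y ord0 i).

Lemma derive_comp1 (F F1 : R -> R) (g : V -> R) v z :
  (forall u, is_derive u (1:R) F (F1 u)) -> elementary_tx g ->
  'D_v (fun z => F (g z)) z = F1 (g z) * 'D_v g z.
Proof. by move=> dF gg; have [_ ->] := differentiable_comp1 (dF (g z)) (elementary_tx_differentiable gg z). Qed.

Lemma derive_const_mul c (g : V -> R) v z : elementary_tx g ->
  'D_v (fun z => c * g z) z = c * 'D_v g z.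
Proof.
move=> gg; rewrite derive_mul; [|exact: differentiable_cst|exact: elementary_tx_differentiable].
by rewrite derive_cst mulr0 addr0.
Qed.

Lemma derive_offset i v z : 'D_v (offset i) z = v.2 ord0 i - velocity z.1 i * v.1.
Proof.
pose f (s : R) : R := y ord0 i + step ((s - s1) * k) * (x - y) ord0 i.
have df (s : R) : is_derive s (1:R) f (velocity s i).
  have -> : f = cst (y ord0 i) + (fun u : R => step ((u - s1) / k^-1)) * cst ((x - y) ord0 i).
    by apply/funext => u; rewrite /f invrK.
  have d2 := is_deriveM (is_derive_step_affine k^-1 s1 s) (is_derive_cst ((x - y) ord0 i) s (1:R)).
  apply: (is_derive_eq (is_deriveD (is_derive_cst (y ord0 i) s (1:R)) d2)).
  by rewrite /velocity /mollifier !invrK /GRing.scale/= !mxE; ring.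
have [h1 h2] := differentiable_time z df.
have -> : offset i = tx_coord (Some i) - (fun z : V => f z.1).
  by apply/funext => u; rewrite offsetE.
rewrite deriveB; [|exact/diff_derivable/tx_coord_differentiable|exact: diff_derivable].
by rewrite h2; have [_ ->] := is_derive_tx_coord (Some i) z v.
Qed.

Lemma derive_depth v z :
  'D_v depth z = - (2 * r ^- 2) * \sum_i offset i z * (v.2 ord0 i - velocity z.1 i * v.1).
Proof.
have dsum : 'D_v (fun z => \sum_i offset i z * offset i z) z =
    \sum_i 2 * (offset i z * (v.2 ord0 i - velocity z.1 i * v.1)).
  have -> : (fun z => \sum_i offset i z * offset i z) = \sum_i (fun z => offset i z * offset i z).
    by apply/funext => u; rewrite fct_sumE.
  rewrite derive_sum; last first.
    by move=> i; apply/diff_derivable/elementary_tx_differentiable/elementary_mul; exact: elementary_offset.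
  apply: eq_bigr => i _; rewrite derive_mul; [|exact/elementary_tx_differentiable/elementary_offset..].
  by rewrite derive_offset; ring.
have gs : elementary_tx (fun z => \sum_i offset i z * offset i z).
  apply: (@elementary_sum _ _ _ _ d (fun i z => offset i z * offset i z)) => i.
  by apply: elementary_mul; exact: elementary_offset.
have -> : depth = fun z => 1 + (- r ^- 2) * \sum_i offset i z * offset i z.
  by apply/funext => u; rewrite /depth mulNr.
rewrite derive_add; [|exact: differentiable_cst|apply: elementary_tx_differentiable; apply: elementary_mul => //; exact: elementary_cst].
by rewrite derive_cst add0r derive_const_mul// dsum -mulr_sumr; ring.
Qed.

Let E (z : V) : R := expR (- b * (z.1 - s0)).

Let derive_E v z : 'D_v E z = - b * E z * v.1.
Proof.
have dE (s : R) : is_derive s (1:R) (fun s : R => expR (- b * (s - s0))) (- b * expR (- b * (s - s0))).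
  have d1 : is_derive s (1:R) (fun s : R => - b * (s - s0)) (- b).
    have -> : (fun s : R => - b * (s - s0)) = cst (- b) * (id - cst s0) by [].
    apply: (is_derive_eq (is_deriveM (is_derive_cst (- b) s (1:R)) (is_deriveB (is_derive_id s (1:R)) (is_derive_cst s0 s (1:R))))).
    by rewrite /GRing.scale/= mulr0 addr0 subr0 mulr1.
  apply: (is_derive_eq (@is_derive1_comp _ expR (fun s : R => - b * (s - s0)) _ _ _ (is_derive_expR _) d1)).
  by rewrite mulrC.
by have [_ ->] := differentiable_time z dE.
Qed.

Lemma derive_barrier v z : 'D_v barrier z =
  E z * (- b * v.1 * cutoff (depth z) + cutoff1 (depth z) * 'D_v depth z).
Proof.
rewrite /barrier derive_mul; [|exact: elementary_tx_differentiable|exact: elementary_tx_differentiable].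
rewrite (derive_comp1 _ _ (@is_derive_cutoff R) elementary_depth) derive_E /E; ring.
Qed.

Lemma derive_barrier_x j : 'D_(dx j) barrier =
  fun z => - (2 * r ^- 2) * (E z * (cutoff1 (depth z) * offset j z)).
Proof.
apply/funext => z; rewrite derive_barrier derive_depth /=.
rewrite (bigD1 j)//= big1 ?addr0.
  by rewrite !mxE !eqxx /=; ring.
by move=> i ij; rewrite !mxE (negbTE ij) mulr0 subr0 mulr0.
Qed.

Lemma derive_depth_x i z : 'D_(dx i) depth z = - (2 * r ^- 2) * offset i z.
Proof.
rewrite derive_depth (bigD1 i)//= big1 ?addr0.
  by rewrite !mxE !eqxx /=; ring.
by move=> j ij; rewrite !mxE (negbTE ij) mulr0 subr0 mulr0.
Qed.

Lemma derive_barrier_xx i j z : 'D_(dx i) ('D_(dx j) barrier) z =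
  E z * (4 * r ^- 2 ^+ 2 * cutoff2 (depth z) * (offset i z * offset j z)
    - 2 * r ^- 2 * cutoff1 (depth z) * (i == j)%:R).
Proof.
rewrite derive_barrier_x derive_const_mul; last first.
  apply: elementary_mul => //; apply: elementary_mul => //; exact: elementary_offset.
rewrite derive_mul; [|exact: elementary_tx_differentiable|apply: elementary_tx_differentiable; apply: elementary_mul => //; exact: elementary_offset].
rewrite derive_mul; [|exact: elementary_tx_differentiable|exact/elementary_tx_differentiable/elementary_offset].
rewrite (derive_comp1 _ _ (@is_derive_cutoff1 R) elementary_depth) derive_E derive_offset derive_depth_x /=.
rewrite !mxE eqxx/= eq_sym; ring.
Qed.

(** Chain rule: the four terms come from the damping factor, from the motion of
the centre, and from the two parts of the Hessian of [cutoff \o depth]. *)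
Lemma parabolic_barrier a z : parabolic a barrier z =
  E z * (- b * cutoff (depth z)
    + 2 * r ^- 2 * cutoff1 (depth z) * \sum_i offset i z * velocity z.1 i
    - 4 * r ^- 2 ^+ 2 * cutoff2 (depth z) * qform (a z.1 z.2) (\row_i offset i z)
    + 2 * r ^- 2 * cutoff1 (depth z) * \sum_i a z.1 z.2 i i).
Proof.
rewrite /parabolic derive_barrier derive_depth /=.
have -> : \sum_i \sum_j a z.1 z.2 i j * 'D_(dx i) ('D_(dx j) barrier) z =
  E z * (4 * r ^- 2 ^+ 2 * cutoff2 (depth z) * qform (a z.1 z.2) (\row_i offset i z)
     - 2 * r ^- 2 * cutoff1 (depth z) * \sum_i a z.1 z.2 i i).
  rewrite /qform mulrBr !mulr_sumr -sumrB; apply: eq_bigr => i _.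
  have -> : a z.1 z.2 i i = \sum_j a z.1 z.2 i j * (i == j)%:R.
    rewrite (bigD1 i)//= eqxx mulr1 big1 ?addr0// => j ji.
    by rewrite eq_sym (negbTE ji) mulr0.
  rewrite !mulr_sumr -sumrB; apply: eq_bigr => j _.
  by rewrite derive_barrier_xx !mxE; ring.
rewrite [X in - (2 * r ^- 2) * X](_ : _ = - \sum_i offset i z * velocity z.1 i).
  by ring.
by rewrite -sumrN; apply: eq_bigr => i _; rewrite mxE; ring.
Qed.

End barrier.

Section barrier_props.
Context {R : realType} {d : nat}.
Notation V := (R * 'rV[R]_d)%type.
Variables (lam Lam : R) (a : R -> 'rV[R]_d -> 'M[R]_d).
Hypotheses (lam0 : 0 < lam) (lL : lam <= Lam) (ell : elliptic lam Lam a).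
Variables (b r s0 s1 k c2 : R) (x y : 'rV[R]_d).
Hypothesis r0 : 0 < r.
Notation K := (2 * d%:R * Lam + 16 * Lam + lam).
Hypothesis hv : forall s, \sum_i velocity s1 k x y s i ^+ 2 <= c2.
Hypothesis bE : b = c2 / lam + K ^+ 2 / (4 * lam) * r ^- 2.
Notation w := (barrier b r s0 s1 k x y).
Notation off := (offset s1 k x y).
Notation dep := (depth r s1 k x y).

Lemma depth_le1 z : dep z <= 1.
Proof.
rewrite lerBlDr lerDl mulr_ge0 ?invr_ge0 ?sqr_ge0//.
by apply: sumr_ge0 => i _; rewrite -expr2 sqr_ge0.
Qed.

(** Near the boundary of the moving ball [depth] tends to [0], and the second
derivative of [cutoff], of order [depth ^ -4], dominates the first one, of order
[depth ^ -2]; away from the boundary the damping term dominates. *)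
Lemma barrier_subsolution : subsolution a w.
Proof.
move=> z; rewrite parabolic_barrier mulr_ge0_le0 ?expR_ge0//.
have [d0|d0] := leP (dep z) 0.
  rewrite cutoff_le0// /cutoff1 /cutoff2 !flat_le0//.
  by rewrite !(mulr0, mul0r, addr0, subr0).
rewrite cutoffE// cutoff1E// cutoff2E//; set e := expR _.
set p := (dep z)^-1; set S := \sum_i _ * _; set Q := qform _ _; set tr := \sum_i _.
have rn : r != 0 by rewrite gt_eqF.
have lamn : lam != 0 by rewrite gt_eqF.
have dn : dep z != 0 by rewrite gt_eqF.
have p1 : 1 <= p by rewrite /p invf_ge1// depth_le1.
pose L2 := \sum_i off i z * off i z.
have L2E : L2 = r ^+ 2 * (1 - p^-1).
  have -> : 1 - p^-1 = r ^- 2 * L2 by rewrite /p invrK /depth opprB addrC subrK.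
  by rewrite mulrA divff ?mul1r// expf_neq0.
have L2e : enorm (\row_i off i z) ^+ 2 = L2.
  by rewrite sqr_enorm; apply: eq_bigr => i _; rewrite mxE expr2.
have [_ _ h] := ell; have /andP[q1 q2] := h z.1 z.2 (\row_i off i z).
rewrite -/(qform _ _) -/Q L2e in q1 q2.
pose A := Q * r ^- 2; have r20 : 0 < r ^- 2 by rewrite invr_gt0 exprn_gt0.
have QE : Q = A * r ^+ 2 by rewrite /A mulfVK// expf_neq0.
have A1 : lam * (1 - p^-1) <= A.
  rewrite -(ler_pM2r (exprn_gt0 2 r0)) -QE; apply: le_trans q1.
  by rewrite L2E -mulrA [r ^+ 2 * _]mulrC.
have p0 : 0 < p by apply: lt_le_trans p1.
have A2 : A <= Lam.
  rewrite -(ler_pM2r (exprn_gt0 2 r0)) -QE; apply: (le_trans q2).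
  rewrite ler_wpM2l ?(le_trans (ltW lam0))// L2E ler_piMr ?sqr_ge0//.
  by rewrite gerBl invr_ge0 ltW.
have htr : tr <= d%:R * Lam by exact: elliptic_trace_le ell.
pose Y := r ^+ 2 * c2 / lam.
(* The Cauchy-Schwarz and Young inequalities in one step: coordinate by
   coordinate, the difference of the two sides is a square. *)
have hS : 2 * p ^+ 2 * S <= p ^+ 4 * A + Y.
  apply: (@le_trans _ _ (lam * p ^+ 4 * r ^- 2 * L2 + r ^+ 2 / lam * \sum_i velocity s1 k x y z.1 i ^+ 2)); last first.
    apply: lerD.
      have -> : lam * p ^+ 4 * r ^- 2 * L2 = p ^+ 4 * ((lam * L2) * r ^- 2) by ring.
      apply: ler_wpM2l; first by rewrite exprn_ge0// ltW.
      by rewrite ler_pM2r.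
    have -> : Y = r ^+ 2 / lam * c2 by rewrite /Y; ring.
    by apply: ler_wpM2l; [rewrite divr_ge0 ?sqr_ge0// ltW|exact: hv].
  rewrite /S /L2 !mulr_sumr -big_split/=; apply: ler_sum => i _.
  rewrite -subr_ge0.
  set l := off i z; set m := velocity _ _ _ _ _ _.
  have -> : lam * p ^+ 4 / r ^+ 2 * (l * l) + r ^+ 2 / lam * m ^+ 2 - 2 * p ^+ 2 * (l * m)
     = (lam * p ^+ 2 * l / r - r * m) ^+ 2 / lam.
    by field; rewrite rn lamn.
  by rewrite divr_ge0 ?sqr_ge0// ltW.
have main := barrier_ineq lam0 lL p1 A1 A2 htr erefl hS.
have -> : - b * e + 2 / r ^+ 2 * (dep z ^- 2 * e) * S
   - 4 * r ^- 2 ^+ 2 * ((p ^+ 4 - p ^+ 3 *+ 2) * e) * Q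
   + 2 / r ^+ 2 * (dep z ^- 2 * e) * tr =
   e * (r ^- 2 * (2 * p ^+ 2 * S + 2 * p ^+ 2 * tr - 4 * (p ^+ 4 - 2 * p ^+ 3) * A) - b).
  by rewrite QE /p; field; rewrite rn dn.
rewrite mulr_ge0_le0 ?expR_ge0// subr_le0.
apply: (@le_trans _ _ (r ^- 2 * (Y + K ^+ 2 / (4 * lam)))).
  by rewrite ler_pM2l.
by rewrite bE /Y le_eqVlt; apply/orP; left; apply/eqP; field; rewrite rn lamn.
Qed.

End barrier_props.

Section barrier_values.
Context {R : realType} {d : nat}.
Notation V := (R * 'rV[R]_d)%type.
Variables (b r s0 s1 t : R) (x y : 'rV[R]_d).
Hypotheses (r0 : 0 < r) (b0 : 0 <= b) (s1t : s1 < t).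
Notation k := (t - s1)^-1.
Notation w := (barrier b r s0 s1 k x y).

Lemma velocity_le (C : R) s : (forall u, step1 u <= C) ->
  \sum_i velocity s1 k x y s i ^+ 2 <= (C * k) ^+ 2 * enorm (x - y) ^+ 2.
Proof.
move=> hC; rewrite sqr_enorm mulr_sumr; apply: ler_sum => i _.
rewrite !mxE /velocity [leLHS]exprMn; apply: ler_wpM2r; first exact: sqr_ge0.
have k0 : 0 <= k by rewrite invr_ge0 subr_ge0 ltW.
have C0 : 0 <= C := le_trans (step1_ge0 0) (hC 0).
rewrite ler_sqr ?nnegrE; [exact: ler_wpM2r|exact: (mulr_ge0 (step1_ge0 _) k0)|exact: mulr_ge0].
Qed.

Lemma barrier_ge0 z : 0 <= w z.
Proof. by rewrite mulr_ge0 ?expR_ge0 ?cutoff_ge0. Qed.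

Lemma barrier_out z : r <= enorm (z.2 - center_path s1 k x y z.1) -> w z = 0.
Proof.
move=> h; rewrite /barrier cutoff_le0 ?mulr0// subr_le0.
have -> : \sum_i offset s1 k x y i z * offset s1 k x y i z = enorm (z.2 - center_path s1 k x y z.1) ^+ 2.
  by rewrite sqr_enorm; apply: eq_bigr => i _; rewrite /offset !mxE expr2.
by rewrite mulrC ler_pdivlMr ?exprn_gt0// mul1r ler_sqr ?nnegrE ?enorm_ge0// ltW.
Qed.

Lemma barrier_support z : ~ closed_box (r + enorm y + enorm (x - y)) z.2 -> w z = 0.
Proof.
move=> h; apply: barrier_out; rewrite leNgt; apply/negP => h'; apply: h => i.
have h1 := le_lt_trans (norm_coord_le_enorm _ i) h'.
have h2 := norm_coord_le_enorm y i.
have h3 := norm_coord_le_enorm (x - y) i.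
have -> : z.2 ord0 i = (z.2 - center_path s1 k x y z.1) ord0 i + y ord0 i
    + step ((z.1 - s1) * k) * (x - y) ord0 i by rewrite !mxE; ring.
apply: (le_trans (ler_normD _ _)); apply: lerD.
  by apply: (le_trans (ler_normD _ _)); apply: lerD => //; exact: ltW.
rewrite normrM; apply: le_trans h3; rewrite ler_piMl// ger0_norm ?step_le1//.
exact: step_ge0.
Qed.

Lemma barrier_final : w (t, x) = expR (- b * (t - s0) - 1).
Proof.
have tn : t - s1 != 0 by rewrite gt_eqF// subr_gt0.
have c : center_path s1 k x y t = x.
  by rewrite /center_path divff// step_ge1// scale1r addrC subrK.
rewrite /barrier /depth/= big1; last by move=> i _; rewrite /offset/= c subrr mulr0.
by rewrite mulr0 subr0 cutoffE// invr1 -expRD.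
Qed.

(** At these times the centre is still at [y] and the damping factor is at
most [1]. *)
Lemma barrier_early s z : s0 <= s -> s <= s1 -> w (s, z) <= \1_(eball y r) z.
Proof.
move=> ss0 ss1; have [h|h] := pselect (eball y r z).
  rewrite indicE mem_set//= /barrier mulr_ile1 ?expR_ge0 ?cutoff_ge0 ?cutoff_le1//.
  by rewrite expR_le1 mulNr oppr_le0 mulr_ge0// subr_ge0.
rewrite barrier_out ?indicE//= leNgt; apply/negP => h'; apply: h.
move: h'; rewrite /center_path step_le0; first by rewrite scale0r addr0.
by rewrite pmulr_lle0 ?invr_gt0 ?subr_gt0// subr_le0.
Qed.

End barrier_values.

(** * The mass of a ball *)

Section ball_mass.
Context {R : realType} {d : nat}.
Local Notation leb := (@lebesgue_measure R).
Local Notation rv := (@lebesgue_rV R d).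

(** This is the Cauchy problem with initial value [1]. *)
Lemma kernel_integrable a (Gamma : R -> 'rV[R]_d -> R -> 'rV[R]_d -> R) s t x :
  fundamental_solution a Gamma -> s < t ->
  rv.-integrable setT (fun y => (Gamma t x s y)%:E).
Proof.
move=> fund st.
have [] := fundamental_cauchy fund s (@measurable_cst _ _ 'rV[R]_d R setT 1).
  by exists 1 => z; rewrite /= normr1.
move=> /(_ t x st) h _ _ _; apply: eq_integrable h => // y _.
by rewrite /= mulr1.
Qed.

(** The barrier is below the indicator function of [eball y r] at all times of
[[s0, s1]], so that the comparison for this single barrier covers almost all of
them with one null set.  That is why its centre rests at [y] until [s1]. *)
Lemma ball_mass_ge lam Lam a (Gamma : R -> 'rV[R]_d -> R -> 'rV[R]_d -> R)
    (C r s0 s1 t : R) (x y : 'rV[R]_d) :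
  0 < lam -> lam <= Lam -> elliptic lam Lam a -> fundamental_solution a Gamma ->
  (forall u : R, step1 u <= C) -> 0 < r -> s1 < t ->
  let K := 2 * d%:R * Lam + 16 * Lam + lam in
  let b := (C * (t - s1)^-1) ^+ 2 * enorm (x - y) ^+ 2 / lam + K ^+ 2 / (4 * lam) * r ^- 2 in
  {ae leb, forall s, s0 <= s <= s1 ->
    ((expR (- b * (t - s0) - 1))%:E <= \int[rv]_(z in eball y r) (Gamma t x s z)%:E)%E}.
Proof.
move=> lam0 lL ell fund hC r0 s1t K b.
have b0 : 0 <= b.
  have lam4 : 0 <= 4 * lam by rewrite mulr_ge0// ltW.
  apply: addr_ge0; first by rewrite divr_ge0 ?(ltW lam0)// mulr_ge0 ?sqr_ge0.
  by rewrite mulr_ge0 ?invr_ge0 ?sqr_ge0// divr_ge0 ?sqr_ge0.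
have hv s := velocity_le x y s1t s hC.
have sub := barrier_subsolution lam0 lL ell s0 r0 hv (erefl b).
have supp z := @barrier_support _ _ b r s0 s1 t x y r0 z.
have := comparison lam0 ell fund (elementary_barrier _ _ _ _ _ _ _) supp sub.
apply: (@filterS _ _ (ae_filter_ringOfSetsType leb)) => s hs /andP[ss0 ss1].
have st := le_lt_trans ss1 s1t.
have := hs t x st; rewrite barrier_final// -lee_fin => /le_trans; apply.
have gi := evolve_integrable fund (elementary_barrier _ _ _ _ _ _ _) supp x st.
rewrite /evolve /Rintegral fineK; last exact: integrable_fin_num.
rewrite [leRHS]integral_mkcond; apply: ge0_le_integral => //=.
- by move=> z _; rewrite lee_fin mulr_ge0 ?barrier_ge0// (fundamental_ge0 fund).
- by have /integrableP[] := gi.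
- apply/(measurable_restrictT _ _).1; first exact: measurable_eball.
  apply: measurable_funS (@subsetT _ _) _ => //.
  by have /integrableP[] := kernel_integrable x fund st.
- move=> z _; rewrite patchE.
  have h := barrier_early x y r0 b0 s1t z ss0 ss1.
  case: ifPn => hz; rewrite lee_fin.
    rewrite ler_piMr ?(fundamental_ge0 fund)//; apply: (le_trans h).
    by rewrite indicE; case: (_ \in _).
  move: h; rewrite indicE (negbTE hz)/= => h.
  by rewrite mulr_ge0_le0// (fundamental_ge0 fund).
Qed.

End ball_mass.

(** * The weak Harnack inequality for the kernel *)

Section harnack.
Context {R : realType} {d : nat}.
Notation V := (R * 'rV[R]_d)%type.
Notation VM := (measurableTypeR R * 'rV[R]_d)%type.
Local Notation leb := (@lebesgue_measure R).
Local Notation rv := (@lebesgue_rV R d).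
Local Notation tx := (@lebesgue_tx R d).

(** A test function on the smaller set is one on the larger set, and the
integrand vanishes off its support. *)
Lemma adjoint_solution_sub a (D D' : set V) v :
  measurable (D' : set VM) -> measurable (D : set VM) -> D' `<=` D ->
  adjoint_solution a D v -> adjoint_solution a D' v.
Proof.
move=> mD' mD D'D [[mv lv] adj]; split.
  split; first exact: measurable_funS mv.
  by move=> K cK KD; apply: lv => //; exact: subset_trans D'D.
move=> phi [sphi [K [cK KD' phi0]]].
have cl : closed K by apply: compact_closed => //; exact: norm_hausdorff.
have tphi : test_function D phi.
  by split => //; exists K; split => //; exact: subset_trans D'D.
apply: etrans (adj phi tphi); rewrite Rintegral_mkcond [RHS]Rintegral_mkcond; apply: eq_Rintegral => z _; rewrite !patchE.
have [zK|nK] := pselect (K z).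
  by rewrite (mem_set (KD' _ zK)) (mem_set (D'D _ (KD' _ zK))).
have z0 : iter_derive [:: dir_t] phi z -
    \sum_i \sum_j a z.1 z.2 i j * iter_derive [:: dir_x i; dir_x j] phi z = 0.
  rewrite /= (derive_outside_closed dir_t cl phi0 nK) big1 ?subrr// => i _; rewrite big1// => j _.
  by rewrite (derive_outside_closed (dir_x i) cl (derive_outside_closed (dir_x j) cl phi0) nK) mulr0.
by rewrite z0 mulr0; case: ifPn; case: ifPn.
Qed.

Lemma measurable_itv_eball (i : interval R) (y : 'rV[R]_d) r :
  measurable ([set` i] `*` eball y r : set VM).
Proof. by apply: measurableX; [exact: measurable_itv|exact: measurable_eball]. Qed.

(** Tonelli's theorem for [v] extended by [0] outside [I `*` B]. *)
Lemma measurable_slice_integral (t : R) (v : V -> R) (B : set 'rV[R]_d) (I : set R) :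
  measurable_fun (`]-oo, t[ `*` [set: 'rV[R]_d] : set VM) v ->
  (forall z, 0 <= v z) -> measurable B -> measurable I -> I `<=` `]-oo, t[ ->
  measurable_fun I (fun s => \int[rv]_(z in B) (v (s, z))%:E)%E.
Proof.
move=> mv v0 mB mI It.
pose g : VM -> \bar R := ((EFin \o v) \_ (I `*` B))%E.
have mIB : measurable (I `*` B : set VM) by exact: measurableX.
have mg : measurable_fun setT g.
  apply/(measurable_restrictT _ _).1 => //; apply/measurable_EFinP.
  by apply: measurable_funS mv; [exact: measurable_past|move=> z [/It ? _]; split].
have g0 z : (0 <= g z)%E.
  by rewrite /g patchE; case: ifPn => // _; rewrite lee_fin.
have := @measurable_fun_fubini_tonelli_F _ _ _ _ _ rv g mg g0.
move=> /(measurable_funS measurableT (@subsetT _ I)).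
apply: eq_measurable_fun => s; rewrite inE => sI.
rewrite /fubini_F [RHS]integral_mkcond; apply: eq_integral => z _.
rewrite /g !patchE; congr (if _ then _ else _).
by apply/idP/idP; rewrite !inE; [case|move=> zB; split].
Qed.

(** The interval of times on which the mass is bounded below has length [r ^ 2],
and [(2 r) ^ d], the volume of a cube, bounds that of the ball from above.  The
strict inequality for [c'] lets one pass from the essential infimum, which is a
supremum of almost everywhere lower bounds, to such a bound. *)
Lemma harnack_ball_mass a (Gamma : R -> 'rV[R]_d -> R -> 'rV[R]_d -> R)
    (T N0 c r s0 t : R) (x y : 'rV[R]_d) :
  weak_harnack a (Num.sqrt T) N0 -> fundamental_solution a Gamma ->
  0 < N0 -> 0 < r -> r < Num.sqrt T -> s0 + 4 * r ^+ 2 <= t -> 0 < c ->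
  {ae leb, forall s, s0 + 2 * r ^+ 2 <= s <= s0 + 3 * r ^+ 2 ->
    (c%:E <= \int[rv]_(z in eball y r) (Gamma t x s z)%:E)%E} ->
  forall c', c' < c / (N0 * (2 * r) ^+ d) ->
  {ae tx, forall z, cylinder s0 y r z -> c' <= Gamma t x z.1 z.2}.
Proof.
move=> wh fund N00 r0 rT st c0 mass c' c'lt.
have r20 : 0 < r ^+ 2 by rewrite exprn_gt0.
have [[mG lG] adj] := fundamental_adjoint fund t x.
have Dsub : cylinder s0 y (2 * r) `<=` `]-oo, t[ `*` [set: 'rV[R]_d].
  move=> z [/= + _]; rewrite !in_itv/= => /andP[_ h]; split => //.
  by rewrite (lt_le_trans h)// (le_trans _ st)// exprMn lerD2l -natrX.
have := wh s0 y r (fun z => Gamma t x z.1 z.2).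
rewrite r0 rT => /(_ isT) /(_ (fun z _ => fundamental_ge0 fund t x z.1 z.2)).
have adj' : adjoint_solution a (cylinder s0 y (2 * r)) (fun z => Gamma t x z.1 z.2).
  apply: (adjoint_solution_sub _ _ Dsub (fundamental_adjoint fund t x)).
  - exact: measurable_itv_eball.
  - exact: measurable_past.
move=> /(_ adj').
set B := eball y r.
pose m := fine (rv B).
have m0 : 0 < m.
  by rewrite fine_gt0// lebesgue_rV_eball_gt0//= -ge0_fin_numE// lebesgue_rV_eball_fin.
have mle : m <= (2 * r) ^+ d.
  by rewrite -lee_fin fineK ?lebesgue_rV_eball_fin// lebesgue_rV_eball_le.
rewrite -/m => H.
have int_ge : ((r ^+ 2 * c)%:E <= \int[leb]_(s in `[(s0 + 2 * r ^+ 2)%R, (s0 + 3 * r ^+ 2)%R])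
    \int[rv]_(z in B) (Gamma t x s z)%:E)%E.
  apply: (@le_trans _ _ (\int[leb]_(s in `[(s0 + 2 * r ^+ 2)%R, (s0 + 3 * r ^+ 2)%R]) (cst c%:E) s)%E).
    rewrite integral_cst//= lebesgue_measure_itv/= lte_fin ltrD2l ltr_pM2r// ltr_nat/=.
    by rewrite -EFinB -EFinM lee_fin le_eqVlt; apply/orP; left; apply/eqP; ring.
  apply: ae_ge0_le_integral => //.
  - by move=> s _; rewrite lee_fin ltW.
  - by move=> s _; apply: integral_ge0 => z _; rewrite lee_fin (fundamental_ge0 fund).
  - apply: (@measurable_slice_integral t (fun z => Gamma t x z.1 z.2)) => //.
    + by move=> z; exact: fundamental_ge0 fund _ _ _ _.
    + exact: measurable_eball.
    + move=> s /=; rewrite !in_itv/= => /andP[_ h]; rewrite (le_lt_trans h)//.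
      by rewrite (lt_le_trans _ st)// ltrD2l ltr_pM2r// ltr_nat.
have H2 : ((c / m)%:E <= N0%:E * ess_inf_on (cylinder s0 y r) (fun z => Gamma t x z.1 z.2))%E.
  apply: le_trans H; apply: (@le_trans _ _ ((r ^+ 2 * m)^-1%:E * (r ^+ 2 * c)%:E)%E).
    rewrite -EFinM lee_fin le_eqVlt; apply/orP; left; apply/eqP; field.
    by rewrite !gt_eqF.
  by apply: lee_wpmul2l => //; rewrite lee_fin invr_ge0 ltW// mulr_gt0.
have H3 : (c'%:E < ess_inf_on (cylinder s0 y r) (fun z => Gamma t x z.1 z.2))%E.
  have N0e : (0 < N0%:E)%E by rewrite lte_fin.
  rewrite -(@lte_pmul2l _ N0%:E)//; apply: lt_le_trans H2.
  rewrite -EFinM lte_fin -ltr_pdivlMl//.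
  apply: (lt_le_trans c'lt); rewrite invfM mulrCA ler_pM2l ?invr_gt0//.
  by rewrite ler_pM2l// lef_pV2// posrE exprn_gt0// mulr_gt0.
have [y0 hy0 c'y0] := ereal_sup_gt H3.
move: hy0; apply: (@filterS _ _ (ae_filter_ringOfSetsType tx)) => z hz /hz h.
by rewrite -lee_fin; apply: le_trans h; exact: ltW.
Qed.

End harnack.

(** * The Gaussian bound *)

Section gaussian.
Context {R : realType} {d : nat}.
Notation V := (R * 'rV[R]_d)%type.
Notation VM := (measurableTypeR R * 'rV[R]_d)%type.
Local Notation leb := (@lebesgue_measure R).
Local Notation rv := (@lebesgue_rV R d).
Local Notation tx := (@lebesgue_tx R d).

(** The power [(t - s) ^ (d / 2)] is written with a square root, whose continuity
is used below; [gaussE] is the link between the two. *)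
Definition gauss (kappa N t : R) (x : 'rV[R]_d) (q : V) : R :=
  (N * Num.sqrt (t - q.1) ^+ d)^-1 *
    expR (- (enorm (x - q.2) ^+ 2 / (kappa * (t - q.1)))).

Lemma powR_half (u : R) n : 0 <= u -> u `^ (n%:R / 2) = Num.sqrt u ^+ n.
Proof.
by move=> u0; rewrite mulrC powRrM powR12_sqrt// powR_mulrn// sqrtr_ge0.
Qed.

Lemma gaussE kappa N t x s y : 0 < t - s ->
  (N * (t - s) `^ (d%:R / 2))^-1 *
    expR (- (enorm (x - y) ^+ 2 / (kappa * (t - s)))) = gauss kappa N t x (s, y).
Proof. by move=> ts; rewrite /gauss powR_half// ltW. Qed.

Lemma gauss_scale kappa N t x q c : gauss kappa (c * N) t x q = c^-1 * gauss kappa N t x q.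
Proof. by rewrite /gauss -mulrA invfM mulrA. Qed.

Lemma gauss_gt0 kappa N t x (q : V) : 0 < N -> 0 < t - q.1 -> 0 < gauss kappa N t x q.
Proof.
by move=> N0 h; rewrite mulr_gt0 ?expR_gt0// invr_gt0 mulr_gt0// exprn_gt0// sqrtr_gt0.
Qed.

Let gtime : elementary_tx (fun z : V => z.1).
Proof. exact: (@elementary_coord _ _ _ (@tx_coord R d) None). Qed.

Let gspace i : elementary_tx (fun z : V => z.2 ord0 i).
Proof. exact: (@elementary_coord _ _ _ (@tx_coord R d) (Some i)). Qed.

Lemma elementary_dist2 (x : 'rV[R]_d) :
  elementary_tx (fun q : V => enorm (x - q.2) ^+ 2).
Proof.
rewrite (_ : (fun q : V => _) = fun q : V => \sum_i (x ord0 i + - q.2 ord0 i) * (x ord0 i + - q.2 ord0 i)).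
  apply: elementary_sum => i.
  by apply: elementary_mul; (apply: elementary_add; [exact: elementary_cst|exact: (elementary_opp (gspace i))]).
apply/funext => q; rewrite sqr_enorm; apply: eq_bigr => i _.
by rewrite !mxE expr2.
Qed.

Lemma elementary_elapsed (t : R) : elementary_tx (fun q : V => t - q.1).
Proof. by apply: elementary_add; [exact: elementary_cst|exact: (elementary_opp gtime)]. Qed.

Lemma gauss_continuous kappa N t x (z : V) : 0 < kappa -> 0 < N -> 0 < t - z.1 ->
  {for z, continuous (gauss kappa N t x)}.
Proof.
move=> k0 N0 tz.
have ct : {for z, continuous (fun q : V => t - q.1)} := @elementary_tx_continuous _ _ _ (elementary_elapsed t) z.
have cS : {for z, continuous (fun q : V => enorm (x - q.2) ^+ 2)} := @elementary_tx_continuous _ _ _ (elementary_dist2 x) z.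
have csq : {for z, continuous (fun q : V => Num.sqrt (t - q.1) ^+ d)}.
  apply: (@continuous_comp _ _ _ (fun q : V => Num.sqrt (t - q.1)) (fun u : R => u ^+ d)).
    apply: (@continuous_comp _ _ _ (fun q : V => t - q.1) (@Num.sqrt R)) => //.
    exact: sqrt_continuous.
  exact: exprn_continuous.
apply: cvgM.
  apply: cvgV; first by rewrite gt_eqF// mulr_gt0// exprn_gt0// sqrtr_gt0.
  by apply: cvgM; [exact: cvg_cst|exact: csq].
apply: (@continuous_comp _ _ _ (fun q : V => - (enorm (x - q.2) ^+ 2 / (kappa * (t - q.1)))) (@expR R)).
  apply: cvgN; apply: cvgM; first exact: cS.
  apply: cvgV; first by rewrite gt_eqF// mulr_gt0.
  by apply: cvgM; [exact: cvg_cst|exact: ct].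
exact: continuous_expR.
Qed.

Lemma elementary_near_gt0 (f : V -> R) z : elementary_tx f -> 0 < f z ->
  \forall q \near nbhs z, 0 < f q.
Proof. by move=> gf fz; exact: (@elementary_tx_continuous _ _ _ gf z _ (lt_nbhsr fz)). Qed.

(** The cylinder given by the weak Harnack inequality starts at its base point.
It is shifted into the past by half of its height in order that [q] lies in its
interior, while the doubled cylinder still ends before time [t]. *)
Definition surrounding_cylinder (t : R) (q : V) : set V :=
  cylinder (q.1 - (t - q.1) / 8) q.2 (Num.sqrt (t - q.1) / 2).

(** Expressed with squared distances, the conditions on [q] are polynomial strict
inequalities. *)
Lemma surrounding_cylinder_near t (z : V) : 0 < t - z.1 -> \forall q \near nbhs z, surrounding_cylinder t q z.
Proof.
move=> tz.
have g0 := elementary_elapsed t.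
have n0 := elementary_near_gt0 g0 tz.
have g1 : elementary_tx (fun q : V => z.1 - q.1 + (t - q.1) * 8^-1).
  apply: elementary_add; first exact: elementary_elapsed.
  by apply: elementary_mul => //; exact: elementary_cst.
have n1 : \forall q \near nbhs z, 0 < z.1 - q.1 + (t - q.1) * 8^-1.
  by apply: (elementary_near_gt0 g1); rewrite subrr add0r divr_gt0.
have g2 : elementary_tx (fun q : V => (- (z.1 - q.1)) + (t - q.1) * 8^-1).
  apply: elementary_add; first exact: (elementary_opp (elementary_elapsed z.1)).
  by apply: elementary_mul => //; exact: elementary_cst.
have n2 : \forall q \near nbhs z, 0 < (- (z.1 - q.1)) + (t - q.1) * 8^-1.
  by apply: (elementary_near_gt0 g2); rewrite subrr oppr0 add0r divr_gt0.
have g3 : elementary_tx (fun q : V => (t - q.1) * 4^-1 + - enorm (z.2 - q.2) ^+ 2).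
  apply: elementary_add; first by apply: elementary_mul => //; exact: elementary_cst.
  exact: (elementary_opp (elementary_dist2 z.2)).
have n3 : \forall q \near nbhs z, 0 < (t - q.1) * 4^-1 + - enorm (z.2 - q.2) ^+ 2.
  apply: (elementary_near_gt0 g3); rewrite sqr_enorm big1 ?subr0 ?divr_gt0// => i _.
  by rewrite !mxE subrr expr0n.
near=> q.
have h0 : 0 < t - q.1 by near: q.
have h1 : 0 < z.1 - q.1 + (t - q.1) * 8^-1 by near: q.
have h2 : 0 < (- (z.1 - q.1)) + (t - q.1) * 8^-1 by near: q.
have h3 : 0 < (t - q.1) * 4^-1 + - enorm (z.2 - q.2) ^+ 2 by near: q.
have r2 : (Num.sqrt (t - q.1) / 2) ^+ 2 = (t - q.1) / 4.
  by rewrite expr_div_n sqr_sqrtr ?(ltW h0)// -natrX.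
split => /=.
  rewrite in_itv/= r2; apply/andP; split; lra.
rewrite /eball/= -ltr_sqr ?nnegrE ?enorm_ge0 ?divr_ge0 ?sqrtr_ge0// r2.
by rewrite -subr_gt0.
Unshelve. all: by end_near. Qed.

Section bounds.
Variables (lam Lam C N0 T : R) (a : R -> 'rV[R]_d -> 'M[R]_d).
Variable Gamma : R -> 'rV[R]_d -> R -> 'rV[R]_d -> R.
Hypotheses (lam0 : 0 < lam) (lL : lam <= Lam) (N00 : 0 < N0).
Hypotheses (C0 : 0 < C) (hC : forall u : R, step1 u <= C).
Hypotheses (ell : elliptic lam Lam a) (wh : weak_harnack a (Num.sqrt T) N0).
Hypothesis fund : fundamental_solution a Gamma.
Notation K := (2 * d%:R * Lam + 16 * Lam + lam).
Notation kappa := (9 * lam / (40 * C ^+ 2)).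
Notation N1 := (N0 * expR (5 * K ^+ 2 / (8 * lam) + 1)).

(** With [tau = t - s] and [r ^ 2 = tau / 4], the averaging interval of the weak
Harnack inequality is [[s + 3 tau / 8, s + 5 tau / 8]].  The centre of the barrier
has [3 tau / 8] left to travel from [y] to [x], and the damping lasts
[5 tau / 8]; this is where the constants [kappa] and [N1] come from. *)
Lemma lt_gauss_le_near t x (q : V) c : 0 < t - q.1 < T -> c < gauss kappa N1 t x q ->
  {ae tx, forall z, surrounding_cylinder t q z -> c <= Gamma t x z.1 z.2}.
Proof.
move=> /andP[tau0 tauT] cg; case: q => s y /= in tau0 tauT cg *.
set tau := t - s in tau0 tauT *.
pose r := Num.sqrt tau / 2.
have sq0 : 0 < Num.sqrt tau by rewrite sqrtr_gt0.
have r0 : 0 < r by rewrite divr_gt0.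
have r2 : r ^+ 2 = tau / 4 by rewrite expr_div_n sqr_sqrtr ?(ltW tau0)// -natrX.
pose s0 := s - tau / 8.
pose b := (C * (t - (s0 + 3 * r ^+ 2))^-1) ^+ 2 * enorm (x - y) ^+ 2 / lam + K ^+ 2 / (4 * lam) * r ^- 2.
have tE : t = s + tau by rewrite /tau addrC subrK.
have s1t : s0 + 3 * r ^+ 2 < t by rewrite r2 /s0 tE; lra.
have mass := ball_mass_ge (s0 + 2 * r ^+ 2) x y lam0 lL ell fund hC r0 s1t.
apply: (harnack_ball_mass wh fund N00 r0 _ _ _ mass).
- rewrite /r; apply: (@lt_trans _ _ (Num.sqrt tau)).
    by rewrite ltr_pdivrMr// ltr_pMr// ltr1n.
  by rewrite ltr_sqrt// (lt_trans tau0).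
- by rewrite r2 /s0 tE; lra.
- exact: expR_gt0.
rewrite -/b; apply: (lt_le_trans cg); rewrite /gauss /= -/tau.
have -> : 2 * r = Num.sqrt tau by rewrite /r mulrC divfK.
have q0 : 0 < Num.sqrt tau ^+ d by rewrite exprn_gt0.
rewrite ler_pdivlMr ?mulr_gt0//; set e1 := expR (5 * _ / _ + 1); set e2 := expR (- (_ / _)).
have -> : (N0 * e1 * Num.sqrt tau ^+ d)^-1 * e2 * (N0 * Num.sqrt tau ^+ d) = e1^-1 * e2.
  by field; rewrite !gt_eqF ?expR_gt0.
rewrite -expRN -expRD ler_expR le_eqVlt; apply/orP; left; apply/eqP.
rewrite /b r2 /s0 tE; field.
by rewrite !gt_eqF//=; lra.
Qed.

Let kappa0 : 0 < kappa.
Proof. by rewrite divr_gt0// mulr_gt0// exprn_gt0. Qed.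

Let N10 : 0 < N1.
Proof. by rewrite mulr_gt0// expR_gt0. Qed.

(** Doubling [N1] makes the inequality of the previous lemma strict. *)
Lemma gauss_le_near t x (q : V) : 0 < t - q.1 < T ->
  {ae tx, forall z, surrounding_cylinder t q z -> gauss kappa (2 * N1) t x q <= Gamma t x z.1 z.2}.
Proof.
move=> h; apply: lt_gauss_le_near => //; rewrite gauss_scale gtr_pMl ?invf_lt1 ?ltr1n//.
by apply: gauss_gt0 => //; case/andP : h.
Qed.

(** The neighbourhoods of the rational points cover, and the second factor [2]
makes up for the difference between the bound at a point and the bound at a
nearby rational point. *)
Lemma ae_gauss t x : {ae tx, forall z, 0 < t - z.1 < T ->
  gauss kappa (2 * (2 * N1)) t x z <= Gamma t x z.1 z.2}.
Proof.
pose pt (p : rat * 'rV[rat]_d) : V := (ratr p.1, ratr_rV p.2).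
have : {ae tx, forall z, forall p, 0 < t - (pt p).1 < T -> surrounding_cylinder t (pt p) z ->
    gauss kappa (2 * N1) t x (pt p) <= Gamma t x z.1 z.2}.
  apply: ae_forall_count => p.
  have [h|h] := pselect (0 < t - (pt p).1 < T); last by apply: aeW => z /h.
  have := gauss_le_near x h.
  by apply: (@filterS _ _ (ae_filter_ringOfSetsType tx)) => z hz _.
apply: (@filterS _ _ (ae_filter_ringOfSetsType tx)) => z hz /andP[tz zT].
have n0 := elementary_near_gt0 (elementary_elapsed t) tz.
have gT : elementary_tx (fun q : V => T - (t - q.1)).
  apply: elementary_add; first exact: elementary_cst.
  exact: (elementary_opp (elementary_elapsed t)).
have nT : \forall q \near nbhs z, 0 < T - (t - q.1).
  by apply: (elementary_near_gt0 gT); rewrite subr_gt0.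
have lt : gauss kappa (2 * (2 * N1)) t x z < gauss kappa (2 * N1) t x z.
  by rewrite [ltLHS]gauss_scale gtr_pMl ?invf_lt1 ?ltr1n// gauss_gt0// mulr_gt0.
have ng : \forall q \near nbhs z, gauss kappa (2 * (2 * N1)) t x z < gauss kappa (2 * N1) t x q.
  have N20 : 0 < 2 * N1 by rewrite mulr_gt0.
  have c := @gauss_continuous kappa (2 * N1) t x z kappa0 N20 tz.
  exact: (c _ (lt_nbhsr lt)).
have [[A B] /= [nA nB] AB] := filterI (filterI n0 nT) (filterI (surrounding_cylinder_near tz) ng).
have [u [_ Au]] := rat_right_nbhs nA.
have [v Bv] := rat_rV_nbhs nB.
have [|[h0 hT] [hatt hg]] := AB (pt (u, v)); first by split.
apply: (le_trans (ltW hg)); apply: hz => //.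
by rewrite h0/= -subr_gt0.
Qed.

(** The small cylinders around [(s, y)] are eventually contained in
[surrounding_cylinder], where the kernel is almost everywhere above the
bound. *)
Lemma representative_gauss t x s y : 0 < t - s < T ->
  ((gauss kappa (2 * (2 * N1)) t x (s, y))%:E <=
     representative (fun z => Gamma t x z.1 z.2) s y)%E.
Proof.
move=> h; have /andP[tau0 tauT] := h.
have key := gauss_le_near x (h : 0 < t - (s, y).1 < T).
apply: (@le_trans _ _ (gauss kappa (2 * N1) t x (s, y))%:E).
  rewrite lee_fin [leLHS]gauss_scale ler_piMl ?invf_le1 ?ler1n// ltW//.
  by rewrite gauss_gt0// mulr_gt0.
set c := gauss _ _ _ _ _ in key *.
have c0 : 0 <= c by rewrite ltW// gauss_gt0// mulr_gt0.
have [[mG _] _] := fundamental_adjoint fund t x.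
set tau := t - s in tau0 tauT.
have sq0 : 0 < Num.sqrt tau by rewrite sqrtr_gt0.
rewrite /representative limf_einfE; apply: le_ereal_sup_tmp.
exists (ereal_inf ((fun rho : R =>
    let Q : set V := `]s - rho ^+ 2, s + rho ^+ 2[ `*` eball y rho in
    (((fine (tx Q))^-1)%:E * \int[tx]_(z in Q) (Gamma t x z.1 z.2)%:E)%E)
    @` [set rho | 0 < rho < Num.sqrt tau / 4])).
  exists [set rho | 0 < rho < Num.sqrt tau / 4] => //.
  exists (Num.sqrt tau / 4) => /=; first by rewrite divr_gt0.
  by move=> rho /= h1 h2; rewrite h2/=; move: h1; rewrite sub0r normrN gtr0_norm.
apply: le_ereal_inf_tmp => _ [rho /= /andP[rho0 rhoT] <-].
set Q : set V := _ `*` _.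
have rho2 : rho ^+ 2 < tau / 16.
  have -> : tau / 16 = (Num.sqrt tau / 4) ^+ 2.
    by rewrite expr_div_n sqr_sqrtr ?(ltW tau0)// -natrX.
  by rewrite ltr_sqr ?nnegrE ?ltW// divr_gt0.
have mQ : measurable (Q : set VM) by exact: measurable_itv_eball.
have QE : tx Q = ((2 * rho ^+ 2) * fine (rv (eball y rho)))%:E.
  have mI : measurable (`]s - rho ^+ 2, s + rho ^+ 2[%classic : set (measurableTypeR R)).
    exact: measurable_itv.
  transitivity (leb `](s - rho ^+ 2)%R, (s + rho ^+ 2)%R[ * rv (eball y rho))%E.
    exact: (product_measure1E leb rv mI (measurable_eball y rho)).
  rewrite EFinM fineK ?lebesgue_rV_eball_fin//; congr (_ * _)%E.
  rewrite lebesgue_measure_itv/= lte_fin ltrD2l gt0_cp ?exprn_gt0//.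
  by rewrite -EFinB; congr (_%:E); ring.
have m0 : 0 < 2 * rho ^+ 2 * fine (rv (eball y rho)).
  rewrite !mulr_gt0// fine_gt0// lebesgue_rV_eball_gt0//=.
  by rewrite -ge0_fin_numE// lebesgue_rV_eball_fin.
rewrite QE /=; set m := _ * fine _ in m0 QE *.
apply: (@le_trans _ _ (m^-1%:E * (c * m)%:E)%E).
  by rewrite -EFinM lee_fin mulrCA mulVf ?mulr1// gt_eqF.
apply: lee_wpmul2l; first by rewrite lee_fin invr_ge0 ltW.
rewrite EFinM -QE -integral_cst//.
apply: ae_ge0_le_integral => //.
- by move=> z _; rewrite lee_fin (fundamental_ge0 fund).
- apply/measurable_EFinP; apply: measurable_funS mG; first exact: measurable_past.
  move=> z [/= + _]; rewrite in_itv/= => /andP[_ hz]; split => //=.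
  rewrite in_itv/=; rewrite /tau in rho2 tau0; lra.
move: key; apply: (@filterS _ _ (ae_filter_ringOfSetsType tx)) => z hz [/= + zB].
rewrite in_itv/= => /andP[z1 z2]; rewrite lee_fin; apply: hz.
have r2 : (Num.sqrt tau / 2) ^+ 2 = tau / 4.
  by rewrite expr_div_n sqr_sqrtr ?(ltW tau0)// -natrX.
split => /=.
  rewrite in_itv/= -/tau r2; apply/andP; split; lra.
apply: (lt_trans zB); apply: (lt_le_trans rhoT); rewrite -/tau; lra.
Qed.

End bounds.

End gaussian.

Unset Implicit Arguments.

Theorem theorem1p4 (R : realType) (d : nat) (lambda Lambda : R) :
  (0 < d)%N -> 0 < lambda -> lambda <= Lambda ->
  exists2 kappa : R, 0 < kappa &
  forall N0 : R, 0 < N0 ->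
  exists2 N : R, 0 < N &
  forall (a : R -> 'rV[R]_d -> 'M[R]_d) (T : R)
    (Gamma : R -> 'rV[R]_d -> R -> 'rV[R]_d -> R),
    elliptic lambda Lambda a ->
    0 < T ->
    weak_harnack a (Num.sqrt T) N0 ->
    fundamental_solution a Gamma ->
    let bound t x s y :=
      (N * (t - s) `^ (d%:R / 2))^-1 *
        expR (- (enorm (x - y) ^+ 2 / (kappa * (t - s)))) in
    forall (t : R) (x : 'rV[R]_d),
      (\forall z \ae lebesgue_tx d, 0 < t - z.1 < T ->
         bound t x z.1 z.2 <= Gamma t x z.1 z.2) /\
      (forall (s : R) (y : 'rV[R]_d), 0 < t - s < T ->
         ((bound t x s y)%:E <=
            representative (fun z => Gamma t x z.1 z.2) s y)%E).
Proof.
move=> _ lam0 lL; have [C C0 hC] := @step1_bounded R.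
exists (9 * lambda / (40 * C ^+ 2)); first by rewrite divr_gt0// mulr_gt0// exprn_gt0.
move=> N0 N00.
pose K := 2 * d%:R * Lambda + 16 * Lambda + lambda.
exists (2 * (2 * (N0 * expR (5 * K ^+ 2 / (8 * lambda) + 1)))).
  by rewrite !mulr_gt0// expR_gt0.
move=> a T Gamma ell T0 wh fund bound t x; split.
  have := ae_gauss lam0 lL N00 C0 hC ell wh fund t x.
  apply: (@filterS _ _ (ae_filter_ringOfSetsType (lebesgue_tx d))) => z hz tz.
  by rewrite /bound gaussE; [case: z hz tz => s y hz; exact: hz|case/andP: tz].
move=> s y ts; rewrite /bound gaussE; last by case/andP: ts.
exact: (representative_gauss lam0 lL N00 C0 hC ell wh fund).
Qed.
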